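(* Let $\lambda\in\mathbb{C}$ with $|\lambda|=1$, let $\varphi_1,\varphi_2,\varphi_3,\varphi_4\in L^\infty$ and let $\Phi=\begin{pmatrix}\varphi_1&\varphi_2\\ \varphi_3&\varphi_4\end{pmatrix}\in L^\infty_{M_2}$. Then the block Toeplitz operator $T_\Phi=\begin{pmatrix}T_{\varphi_1}&T_{\varphi_2}\\ T_{\varphi_3}&T_{\varphi_4}\end{pmatrix}$ on $H^2_{\mathbb{C}^2}$ is complex symmetric with the conjugation $\mathcal{C}=\frac{1}{\sqrt2}\begin{pmatrix}C_{1,\lambda}&C_{1,\lambda}\\ C_{1,\lambda}&-C_{1,\lambda}\end{pmatrix}$ if and only if $$\begin{cases}\varphi_1(z)=\frac12\sum_{j=1}^{4}\varphi_j(\lambda\overline z)\\ \varphi_2(z)=\frac12\sum_{j=1}^{2}[\varphi_j(\lambda\overline z)-\varphi_{j+2}(\lambda\overline z)]\\ \varphi_3(z)=\frac12\sum_{j=1}^{4}(-1)^{j+1}\varphi_j(\lambda\overline z)\\ \varphi_4(z)=\frac12\sum_{j=1}^{2}(-1)^{j+1}[\varphi_j(\lambda\overline z)-\varphi_{j+2}(\lambda\overline z)]\end{cases}$$ on $|z|=1$ (almost everywhere).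
   Context: $L^2$ and $L^\infty$ are the Lebesgue spaces on the unit circle $\partial\mathbb{D}$, $H^2$ is the Hardy space of the unit disk (viewed as a closed subspace of $L^2$), and $P$ is the orthogonal projection of $L^2$ onto $H^2$. For $\varphi\in L^\infty$, $T_\varphi f=P(\varphi f)$, $f\in H^2$, is the Toeplitz operator. $M_2$ is the set of $2\times2$ complex matrices, $L^\infty_{M_2}=L^\infty\otimes M_2$, $L^2_{\mathbb{C}^2}=L^2\otimes\mathbb{C}^2$, $H^2_{\mathbb{C}^2}=H^2\otimes\mathbb{C}^2=H^2\oplus H^2$; for $\Phi\in L^\infty_{M_2}$ the block Toeplitz operator is $T_\Phi h=P_2(\Phi h)$, $h\in H^2_{\mathbb{C}^2}$, with $P_2$ the orthogonal projection of $L^2_{\mathbb{C}^2}$ onto $H^2_{\mathbb{C}^2}$. For $|\lambda|=1$, $C_{1,\lambda}:H^2\to H^2$ is the conjugation $C_{1,\lambda}f(z)=\overline{f(\lambda\overline z)}$. A conjugation on a Hilbert space is an antilinear map $C$ with $C^2=I$ and $\langle Cx,Cy\rangle=\langle y,x\rangle$ for all $x,y$. A bounded operator $T$ is complex symmetric with the conjugation $C$ if $T=CT^*C$. *)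

(* Defs.v *)
From HB Require Import structures.
From mathcomp Require Import all_boot all_order all_algebra.
From mathcomp Require Import complex.
From mathcomp Require Import all_classical all_reals all_analysis.
From mathcomp Require Import measurable_realfun ess_sup_inf.

Set Implicit Arguments.
Unset Strict Implicit.
Unset Printing Implicit Defensive.

Import Order.TTheory GRing.Theory Num.Theory.
Import numFieldNormedType.Exports.

Local Open Scope classical_set_scope.
Local Open Scope ring_scope.
Local Open Scope quotient_scope.

(** * Operators on complex inner product spaces *)

Section InnerProduct.
Context {R : realType} {H : lmodType R[i]}.
Variable dot : H -> H -> R[i].

Definition hnorm (x : H) : R := Num.sqrt (complex.Re (dot x x)).

Definition bounded_operator (T : H -> H) : Prop :=
  linear T /\ exists M : R, forall x, hnorm (T x) <= M * hnorm x.

Definition antilinear (K : H -> H) : Prop :=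
  forall (a : R[i]) (x y : H), K (a *: x + y) = a^* *: K x + K y.

Definition conjugation (K : H -> H) : Prop :=
  [/\ antilinear K, involutive K & forall x y, dot (K x) (K y) = dot y x].

Definition is_adjoint (T Ts : H -> H) : Prop :=
  forall x y, dot (T x) y = dot x (Ts y).

(* T = K T^* K; the adjoint Ts of T is unique when dot is positive definite. *)
Definition complex_symmetric (T K : H -> H) : Prop :=
  [/\ bounded_operator T, conjugation K &
      exists2 Ts : H -> H, is_adjoint T Ts & T = K \o Ts \o K].

(* The orthogonal projection of H onto a subspace given by its inclusion map
   incl : W -> H, as a map into W.  The default value 0 is irrelevant when
   every vector has a projection, as is the case for closed subspaces of
   Hilbert spaces. *)
Definition orthogonal_projection (W : lmodType R[i]) (incl : W -> H) (x : H)
    : W :=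
  xget 0 [set y | forall w : W, dot (x - incl y) (incl w) = 0].

End InnerProduct.

Section DirectSum.
Context {R : realType} {H : lmodType R[i]}.

Definition sum_dot (dot : H -> H -> R[i]) (x y : H * H) : R[i] :=
  dot x.1 y.1 + dot x.2 y.2.

Definition operator_mx2 (A B C D : H -> H) (x : H * H) : H * H :=
  (A x.1 + B x.2, C x.1 + D x.2).

End DirectSum.

Definition mx2 (T : Type) (a b c d : T) : 'M[T]_2 :=
  \matrix_(i, j) if i == ord0 then (if j == ord0 then a else b)
                 else (if j == ord0 then c else d).

(** * Lebesgue spaces on the unit circle *)

(* Functions on the unit circle are represented by functions on the complex
   plane; only their values at the points cis t, 0 <= t <= 2 pi, matter. *)

Section Circle.
Variable R : realType.

Definition cis (t : R) : R[i] := Complex (cos t) (sin t).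

Definition arc_length := [the measure _ R of mrestr (@lebesgue_measure R)
  (measurable_itv `[0, (pi *+ 2)] : measurable (`[0, (pi *+ 2)] : set R))].

Definition ae_circle (P : R[i] -> Prop) : Prop :=
  {ae arc_length, forall t, P (cis t)}.

Lemma ae_circleS (P Q : R[i] -> Prop) :
  (forall z, P z -> Q z) -> ae_circle P -> ae_circle Q.
Proof.
move=> PQ; rewrite /ae_circle.
by apply: (@filterS _ _ (ae_filter_ringOfSetsType arc_length)) => t; exact: PQ.
Qed.

Lemma ae_circleS2 (P Q S : R[i] -> Prop) :
  (forall z, P z -> Q z -> S z) -> ae_circle P -> ae_circle Q -> ae_circle S.
Proof.
move=> PQ; rewrite /ae_circle.
by apply: (@filterS2 _ _ (ae_filter_ringOfSetsType arc_length)) => t; exact: PQ.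
Qed.

(* Integral against the normalised arc length d theta / (2 pi). *)
Definition circle_int (f : R[i] -> R[i]) : R[i] :=
  ((pi *+ 2)^-1)%:C%C *
  Complex (\int[arc_length]_t complex.Re (f (cis t)))%R
          (\int[arc_length]_t complex.Im (f (cis t)))%R.

(* L^p of the circle: Borel functions whose real and imaginary parts have a
   finite p-norm (essential supremum for p = +oo). *)
Definition circle_Lfun (p : \bar R) : {pred R[i] -> R[i]^o} :=
  [pred f | ((fun t => complex.Re (f (cis t))) \in Lfun arc_length p) &&
            ((fun t => complex.Im (f (cis t))) \in Lfun arc_length p)].

Definition Linfty : {pred R[i] -> R[i]^o} := circle_Lfun +oo%E.

Lemma circle_Lfun_submod_closed (p : \bar R) :
  (1 <= p)%E -> submod_closed (circle_Lfun p).
Proof.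
move=> p1; have [L0 LD] := @Lfun_submod_closed _ _ R arc_length p p1.
split; first by rewrite inE; apply/andP; split; apply: L0.
move=> a f g /andP[fr fi] /andP[gr gi]; apply/andP; split.
- rewrite (_ : (fun t => _) = complex.Re a *: (fun t => complex.Re (f (cis t))) +
    (- complex.Im a *: (fun t => complex.Im (f (cis t))) +
     (fun t => complex.Re (g (cis t))))); last first.
    apply/funext => t; rewrite /= !fctE.
    by case: a (f _) (g _) => [a b] [c d] [e h] /=; rewrite scaleNr addrA.
  by apply: (LD) => //; apply: (LD).
- rewrite (_ : (fun t => _) = complex.Re a *: (fun t => complex.Im (f (cis t))) +
    (complex.Im a *: (fun t => complex.Re (f (cis t))) +
     (fun t => complex.Im (g (cis t))))); last first.
    apply/funext => t; rewrite /= !fctE.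
    by case: a (f _) (g _) => [a b] [c d] [e h] /=; rewrite addrA.
  by apply: (LD) => //; apply: (LD).
Qed.


HB.instance Definition _ := GRing.isSubmodClosed.Build R[i] (R[i] -> R[i]^o)
  (circle_Lfun 2%:E) (circle_Lfun_submod_closed (lee1n 2)).

(* L^2 is the space of square integrable functions modulo equality almost
   everywhere on the circle. *)
Record L2fun := MkL2fun {
  L2fun_val :> R[i] -> R[i]^o;
  L2fun_prop : L2fun_val \in circle_Lfun 2%:E }.

HB.instance Definition _ := [isSub for L2fun_val].
HB.instance Definition _ := [Choice of L2fun by <:].
HB.instance Definition _ := [SubChoice_isSubLmodule of L2fun by <:].

Definition L2null : {pred L2fun} :=
  [pred f | `[< ae_circle (fun z => L2fun_val f z = 0) >]].

Lemma L2null_submod_closed : submod_closed L2null.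
Proof.
split; first by apply/asboolP; exact: aeW.
move=> a f g /asboolP f0 /asboolP g0; apply/asboolP.
apply: ae_circleS2 f0 g0 => z /= f0 g0.
by rewrite -[LHS]/(a *: f z + _) f0 g0 scaler0 addr0.
Qed.

HB.instance Definition _ := GRing.isSubmodClosed.Build R[i] L2fun
  L2null L2null_submod_closed.

Definition L2 := {ideal_quot L2null}.
HB.instance Definition _ := Choice.on L2.
HB.instance Definition _ := GRing.Zmodule.on L2.
HB.instance Definition _ := EqQuotient.on L2.
HB.instance Definition _ := ZmodQuotient.on L2.

Lemma L2P (f g : L2fun) :
  reflect (ae_circle (fun z => L2fun_val f z = L2fun_val g z)) (f == g %[mod L2]).
Proof.
rewrite -Quotient.idealrBE; apply: (iffP idP) => [/asboolP|fg].
  by apply: ae_circleS => z /eqP; rewrite subr_eq0 => /eqP.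
apply/asboolP; apply: ae_circleS fg => z fg.
by rewrite -[LHS]/(f z - g z) fg subrr.
Qed.

Definition L2scale (a : R[i]) := lift_op1 L2 ( *:%R a).

Fact pi_L2scale a : {morph \pi_L2 : f / a *: f >-> L2scale a f}.
Proof.
move=> f; unlock L2scale; apply/eqP; apply/L2P.
have /eqP/L2P := reprK (\pi_L2 f); apply: ae_circleS => z.
by move=> fE; exact: (congr1 (fun x : R[i]^o => a *: x) (esym fE)).
Qed.

Fact L2scaleA a b f : L2scale a (L2scale b f) = L2scale (a * b) f.
Proof. by rewrite -[f]reprK -!pi_L2scale scalerA. Qed.

Fact L2scale1 : left_id 1 L2scale.
Proof. by move=> f; rewrite -[f]reprK -pi_L2scale scale1r. Qed.

Fact L2scaleDr : right_distributive L2scale +%R.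
Proof.
move=> a f g; rewrite -[f]reprK -[g]reprK.
have piD (x y : L2fun) : \pi_L2 x + \pi_L2 y = \pi_L2 (x + y) by rewrite raddfD.
by rewrite piD -!pi_L2scale piD scalerDr.
Qed.

Fact L2scaleDl f : {morph L2scale^~ f : a b / a + b}.
Proof.
by move=> a b; rewrite -[f]reprK -!pi_L2scale -raddfD scalerDl.
Qed.

HB.instance Definition _ :=
  GRing.Zmodule_isLmodule.Build R[i] L2 L2scaleA L2scale1 L2scaleDr L2scaleDl.

Lemma circle_int_ae f g : f \in circle_Lfun 1 -> g \in circle_Lfun 1 ->
  ae_circle (fun z => f z = g z) -> circle_int f = circle_int g.
Proof.
have int_ae (u v : R -> R) : u \in Lfun arc_length 1 ->
    v \in Lfun arc_length 1 -> {ae arc_length, forall t, u t = v t} ->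
    \int[arc_length]_t u t = \int[arc_length]_t v t.
  move=> /Lfun1_integrable/measurable_int mu_ /Lfun1_integrable/measurable_int mv.
  move=> uv; congr fine; apply: ae_eq_integral => //.
  by apply: (@filterS _ _ (ae_filter_ringOfSetsType arc_length)) uv => t /= ->.
move=> /andP[fr fi] /andP[gr gi] fg; congr (_ * Complex _ _); apply: int_ae => //.
- by apply: (@filterS _ _ (ae_filter_ringOfSetsType arc_length)) fg => t /= ->.
- by apply: (@filterS _ _ (ae_filter_ringOfSetsType arc_length)) fg => t /= ->.
Qed.

Lemma circle_int_linear a (f g : R[i] -> R[i]^o) :
  f \in circle_Lfun 1 -> g \in circle_Lfun 1 ->
  circle_int (a *: f + g) = a * circle_int f + circle_int g.
Proof.
move=> /andP[/Lfun1_integrable fr /Lfun1_integrable fi].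
move=> /andP[/Lfun1_integrable gr /Lfun1_integrable gi].
have IZ (c : R) (u : R -> R) : arc_length.-integrable setT (EFin \o u) ->
    arc_length.-integrable setT (EFin \o (fun t => c * u t)).
  by move=> ui; have := integrableZl measurableT c ui; apply: eq_integrable.
have ID (u v : R -> R) : arc_length.-integrable setT (EFin \o u) ->
    arc_length.-integrable setT (EFin \o v) ->
    arc_length.-integrable setT (EFin \o (fun t => u t + v t)).
  by move=> ui vi; have := integrableD measurableT ui vi; apply: eq_integrable.
rewrite /circle_int mulrCA -mulrDr; congr (_ * _).
rewrite (_ : \int[arc_length]_t complex.Re _ = \int[arc_length]_t
   (complex.Re a * complex.Re (f (cis t)) +
    (- complex.Im a * complex.Im (f (cis t)) + complex.Re (g (cis t)))));
  last first.
  apply: eq_Rintegral => t _; rewrite /= !fctE.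
  by case: a (f _) (g _) => [a b] [c d] [e h] /=; rewrite mulNr addrA.
rewrite (_ : \int[arc_length]_t complex.Im _ = \int[arc_length]_t
   (complex.Re a * complex.Im (f (cis t)) +
    (complex.Im a * complex.Re (f (cis t)) + complex.Im (g (cis t)))));
  last first.
  apply: eq_Rintegral => t _; rewrite /= !fctE.
  by case: a (f _) (g _) => [a b] [c d] [e h] /=; rewrite addrA.
rewrite RintegralD ?RintegralZl//; try by [exact: IZ|apply: ID => //; exact: IZ].
rewrite RintegralD ?RintegralZl//; try by [exact: IZ].
rewrite RintegralD ?RintegralZl//; try by [exact: IZ|apply: ID => //; exact: IZ].
rewrite RintegralD ?RintegralZl//; try by [exact: IZ].
by case: a => a b /=; rewrite mulNr !addrA.
Qed.

Lemma circle_Lfun_mul (f g : R[i] -> R[i]^o) :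
  f \in circle_Lfun 2%:E -> g \in circle_Lfun 2%:E ->
  (fun z => f z * g z) \in circle_Lfun 1.
Proof.
move=> /andP[fr fi] /andP[gr gi].
have [_ LD] := @Lfun_submod_closed _ _ R arc_length 1 (lexx 1%E).
apply/andP; split.
- rewrite (_ : (fun t => _) =
    -1 *: ((fun t => complex.Im (f (cis t))) \* (fun t => complex.Im (g (cis t))))
    + ((fun t => complex.Re (f (cis t))) \* (fun t => complex.Re (g (cis t)))));
    last first.
    apply/funext => t /=; rewrite !fctE scaleN1r addrC /=.
    by case: (f _) (g _) => [a b] [c d].
  by apply: LD; exact: Lfun2_mul_Lfun1.
- rewrite (_ : (fun t => _) =
    1 *: ((fun t => complex.Re (f (cis t))) \* (fun t => complex.Im (g (cis t))))
    + ((fun t => complex.Im (f (cis t))) \* (fun t => complex.Re (g (cis t)))));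
    last first.
    apply/funext => t /=; rewrite !fctE scale1r /=.
    by case: (f _) (g _) => [a b] [c d].
  by apply: LD; exact: Lfun2_mul_Lfun1.
Qed.

Lemma circle_Lfun_conj p (f : R[i] -> R[i]^o) :
  f \in circle_Lfun p -> (fun z => (f z)^*) \in circle_Lfun p.
Proof.
move=> /andP[fr fi]; apply/andP; split.
  by rewrite (_ : (fun t => _) = (fun t => complex.Re (f (cis t))))//;
    apply/funext => t; case: (f _).
rewrite (_ : (fun t => _) = - (fun t => complex.Im (f (cis t))));
  last by apply/funext => t; rewrite fctE; case: (f _).
exact: Lfun_oppr_closed.
Qed.

Lemma cisX (t : R) n : cis t ^+ n = cis (t *+ n).
Proof.
elim: n => [|n IHn]; first by rewrite expr0 mulr0n /cis cos0 sin0.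
by rewrite exprS IHn mulrS /cis cosD sinD; congr Complex; rewrite addrC mulrC.
Qed.

Lemma cisV (t : R) : (cis t)^-1 = cis (- t).
Proof.
rewrite /cis cosN sinN -[LHS]/(Complex _ _).
by rewrite cos2Dsin2 !divr1.
Qed.

Lemma circle_Lfun_zpow (n : int) : (fun z => z ^ n) \in circle_Lfun 2%:E.
Proof.
have [s cisE] : exists s : R, forall t, cis t ^ n = cis (s * t).
  case: n => n; first by exists n%:R => t; rewrite -exprnP cisX mulr_natl.
  by exists (- n.+1%:R) => t; rewrite NegzE -exprnN -exprVn cisV cisX mulNrn mulNr mulr_natl.
have arcT : (arc_length setT \is a fin_num)%E.
  by rewrite /= /mrestr setTI lebesgue_measure_itv /=; case: ifP.
have bndL (g : R -> R) : continuous g -> (forall x, `|g x| <= 1) ->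
    (fun t => g (s * t)) \in Lfun arc_length 2%:E.
  move=> cg g1; apply: (Lfun_subset (q := +oo%E) (lee1n 2)) => //; rewrite ?leey//.
  apply/andP; split; rewrite inE /=.
    apply: (@measurableT_comp _ _ _ _ _ _ g _ (fun t => s * t)).
      exact: continuous_measurable_fun.
    exact: measurable_funM.
  rewrite /finite_norm unlock /Lnorm; case: ifP => // _.
  apply: (@le_lt_trans _ _ 1%:E); last exact: ltry.
  by apply/ess_supP/nearW => t /=; rewrite lee_fin.
apply/andP; split.
- rewrite (_ : (fun t => _) = fun t => cos (s * t)); last first.
    by apply/funext => t; rewrite cisE.
  apply: bndL => [|x]; first exact: continuous_cos.
  by rewrite ler_norml cos_geN1 cos_le1.
- rewrite (_ : (fun t => _) = fun t => sin (s * t)); last first.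
    by apply/funext => t; rewrite cisE.
  apply: bndL => [|x]; first exact: continuous_sin.
  by rewrite ler_norml sin_geN1 sin_le1.
Qed.

(* The class of f in L^2; the default is 0 when f is not square integrable. *)
Definition toL2 (f : R[i] -> R[i]) : L2 := \pi_L2 (insubd (0 : L2fun) f).

Definition L2dot (f g : L2) : R[i] :=
  circle_int (fun z => L2fun_val (repr f) z * (L2fun_val (repr g) z)^*).

Definition fourier (f : L2) (n : int) : R[i] :=
  circle_int (fun z => L2fun_val (repr f) z * (z ^ n)^*).

(* H^2 as the subspace of L^2 of functions with vanishing negative Fourier
   coefficients. *)
Definition hardy : {pred L2} :=
  [pred f | `[< forall n : int, n < 0 -> fourier f n = 0 >]].

Lemma fourier_linear a f g n :
  fourier (a *: f + g) n = a * fourier f n + fourier g n.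
Proof.
have zL := circle_Lfun_conj (circle_Lfun_zpow n).
have hL (h : L2fun) := circle_Lfun_mul (L2fun_prop h) zL.
rewrite /fourier -circle_int_linear//.
rewrite (@circle_int_ae _ (fun z => L2fun_val (a *: repr f + repr g) z * (z ^ n)^* ))//.
  congr circle_int; apply/funext => z; rewrite !fctE.
  by rewrite -[L2fun_val _ z]/(a * L2fun_val (repr f) z + L2fun_val (repr g) z) mulrDl -mulrA.
have /L2P : repr (a *: f + g) == a *: repr f + repr g %[mod L2].
  by rewrite reprK raddfD /= pi_L2scale !reprK.
by apply: ae_circleS => z ->.
Qed.

Lemma hardy_submod_closed : submod_closed hardy.
Proof.
have F0 n : fourier 0 n = 0.
  have := fourier_linear 1 0 0 n.
  by rewrite scaler0 add0r mul1r => /esym/eqP; rewrite -subr_eq0 addrK => /eqP.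
split; first by apply/asboolP => n _.
move=> a f g /asboolP f0 /asboolP g0; apply/asboolP => n n0.
by rewrite fourier_linear f0// g0// mulr0 addr0.
Qed.

HB.instance Definition _ :=
  GRing.isSubmodClosed.Build R[i] L2 hardy hardy_submod_closed.

Record H2 := MkH2 { H2val :> L2; H2prop : H2val \in hardy }.

HB.instance Definition _ := [isSub for H2val].
HB.instance Definition _ := [Choice of H2 by <:].
HB.instance Definition _ := [SubChoice_isSubLmodule of H2 by <:].

Definition H2dot (f g : H2) : R[i] := L2dot (H2val f) (H2val g).

(** * Block Toeplitz operators and the conjugations C_{1,lambda} *)

(* For bounded phi the product is square integrable, so that the default in
   toL2 is not used. *)
Definition mulL2 (phi : R[i] -> R[i]) (f : L2) : L2 :=
  toL2 (fun z => phi z * L2fun_val (repr f) z).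

Definition H2C2_incl (h : H2 * H2) : L2 * L2 := (H2val h.1, H2val h.2).

Definition proj_H2C2 : L2 * L2 -> H2 * H2 :=
  orthogonal_projection (sum_dot L2dot) H2C2_incl.

Definition block_toeplitz (Phi : 'M[R[i] -> R[i]]_2) (h : H2 * H2) : H2 * H2 :=
  proj_H2C2
    (operator_mx2 (mulL2 (Phi ord0 ord0)) (mulL2 (Phi ord0 ord_max))
       (mulL2 (Phi ord_max ord0)) (mulL2 (Phi ord_max ord_max)) (H2C2_incl h)).

(* C_{1,lambda} f (z) = conj (f (lambda conj z)).  The defaults in toL2 and
   insubd are not used when |lambda| = 1, since this formula preserves the
   Hardy space. *)
Definition C1 (lambda : R[i]) (f : H2) : H2 :=
  insubd (0 : H2) (toL2 (fun z => (L2fun_val (repr (H2val f)) (lambda * z^* ))^* )).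

Definition C1_block (lambda : R[i]) (h : H2 * H2) : H2 * H2 :=
  (sqrtC 2)^-1 *: operator_mx2 (C1 lambda) (C1 lambda)
                               (C1 lambda) (fun f => - C1 lambda f) h.

End Circle.

Arguments Linfty R : clear implicits.
Arguments H2dot {R} f g.

(* Main.v *)
Require Import Defs.
From mathcomp Require Import all_boot all_order all_algebra.
From mathcomp Require Import complex ring lra.
From mathcomp Require Import all_classical all_reals all_analysis.
From mathcomp Require Import measurable_realfun ess_sup_inf.

Set Implicit Arguments.
Unset Strict Implicit.
Unset Printing Implicit Defensive.

Import Order.TTheory GRing.Theory Num.Theory.
Import numFieldNormedType.Exports.
Local Open Scope classical_set_scope.
Local Open Scope ring_scope.
Local Open Scope quotient_scope.

(** For a conjugation [C], the equation T = C T^* C says that the form <T h, k>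
    equals <T C k, C h> for all [h] and [k]; conversely this identity makes
    C T C the adjoint of [T] ([complex_symmetric_form]).  For the block Toeplitz
    operator the projection onto H^2 disappears from <T h, k>, which becomes a
    sum of four integrals of phi_ij h_j conj(k_i) over the circle
    ([block_toeplitz_form]).

    Write rho for the reflection z |-> lambda conj(z).  It preserves arc length,
    so conjugating both arguments of such an integral by C_{1,lambda} exchanges
    them and replaces phi by phi o rho ([mul_form_reflect]).  The constant
    matrix W = (1, 1; 1, -1) / sqrt 2 then mixes the entries: <T C k, C h> is
    the form of the symbol W (Phi o rho)^T W ([block_form_C1_block]), whose
    entries are the right-hand sides of the four equations.

    The theorem follows because the form determines the symbol almost
    everywhere ([block_form_eq]).  On monomials the form yields all Fourier
    coefficients of the symbol, and an integrable function whose Fourier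
    coefficients vanish is 0 ([fourier_uniqueness]): trigonometric polynomials
    approximate the indicators of arcs boundedly, so its integral over every
    arc is 0.

    The form represents the operator only if the projection onto H^2 exists.
    This is the projection theorem for closed subspaces
    ([projection_exists]), applied to L^2, which is complete by the
    Riesz-Fischer argument ([riesz_fischer], [complete_L2]). *)

(** * Complex inner product spaces *)

Section ComplexParts.
Context {R : realType}.
Implicit Types z w : R[i].

Definition normsq z : R := complex.Re z ^+ 2 + complex.Im z ^+ 2.

Lemma mul_conjC z : z * z^* = (normsq z)%:C%C.
Proof.
case: z => a b; rewrite /normsq; apply/eqP; rewrite eq_complex /=.
by apply/andP; split; apply/eqP; ring.
Qed.

Lemma normsq_ge0 z : 0 <= normsq z.
Proof. by rewrite addr_ge0 ?sqr_ge0. Qed.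

Lemma normsq_eq0 z : normsq z = 0 -> z = 0.
Proof.
move=> /eqP; rewrite paddr_eq0 ?sqr_ge0// !sqrf_eq0.
by case: z => a b /= /andP[/eqP-> /eqP->].
Qed.

Lemma normsqD z w : normsq (z + w) <= 2 * (normsq z + normsq w).
Proof.
case: z w => a b [c d]; rewrite /normsq /=.
by have := sqr_ge0 (a - c); have := sqr_ge0 (b - d); nra.
Qed.

Lemma normsqM z w : normsq (z * w) = normsq z * normsq w.
Proof. by case: z w => a b [c d]; rewrite /normsq /=; ring. Qed.

Lemma ReD z w : complex.Re (z + w) = complex.Re z + complex.Re w.
Proof. by case: z w => ? ? []. Qed.

End ComplexParts.

Lemma geometric_le0 (R : realType) (a C : R) : 0 <= C ->
  (forall n : nat, a <= C * 4^-1 ^+ n) -> a <= 0.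
Proof.
move=> C0 aC; apply/ler_addgt0Pr => e e0; rewrite add0r.
have [n _ /(_ n (leqnn n))] : \forall n \near \oo, `|C * 4^-1 ^+ n| < e.
  have : geometric C (4^-1 : R) @ \oo --> (0 : R).
    by apply: cvg_geometric; rewrite ger0_norm ?invr_ge0// invf_lt1 ?ltr1n.
  by move=> /cvgr0Pnorm_lt /(_ _ e0).
by move=> /(le_lt_trans (ler_norm _))/ltW; apply: le_trans.
Qed.

Section InnerProduct.
Context {R : realType} {H : lmodType R[i]}.

Record inner_product (dot : H -> H -> R[i]) : Prop := InnerProduct {
  dotPl : forall a x y z, dot (a *: x + y) z = a * dot x z + dot y z;
  dotC : forall x y, dot y x = (dot x y)^*;
  dot_ge0 : forall x, 0 <= dot x x;
  dot_eq0 : forall x, dot x x = 0 -> x = 0 }.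

Variable dot : H -> H -> R[i].
Hypothesis ip : inner_product dot.
Implicit Types (x y z w : H).

Definition sqnorm x : R := complex.Re (dot x x).

Lemma sqnormE x : dot x x = (sqnorm x)%:C%C.
Proof.
have := dot_ge0 ip x; rewrite lecE /= => /andP[/eqP I0 _].
by rewrite /sqnorm; case: (dot x x) I0 => a b /= ->.
Qed.

Lemma sqnorm_ge0 x : 0 <= sqnorm x.
Proof. by have := dot_ge0 ip x; rewrite lecE /= => /andP[]. Qed.

Lemma sqnorm_eq0 x : sqnorm x = 0 -> x = 0.
Proof. by move=> x0; apply: (dot_eq0 ip); rewrite sqnormE x0. Qed.

Lemma dot0l y : dot 0 y = 0.
Proof.
have := dotPl ip 1 0 0 y; rewrite scaler0 add0r mul1r.
by move/eqP; rewrite -subr_eq0 opprD addrA subrr sub0r oppr_eq0 => /eqP.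
Qed.

Lemma dotDl x y z : dot (x + y) z = dot x z + dot y z.
Proof. by rewrite -[x in LHS]scale1r (dotPl ip) mul1r. Qed.

Lemma dotZl a x y : dot (a *: x) y = a * dot x y.
Proof. by rewrite -[a *: x in LHS]addr0 (dotPl ip) dot0l addr0. Qed.

Lemma dotNl x y : dot (- x) y = - dot x y.
Proof. by rewrite -scaleN1r dotZl mulN1r. Qed.

Lemma dotBl x y z : dot (x - y) z = dot x z - dot y z.
Proof. by rewrite dotDl dotNl. Qed.

Lemma dotDr x y z : dot x (y + z) = dot x y + dot x z.
Proof. by rewrite (dotC ip) dotDl rmorphD /= -!(dotC ip). Qed.

Lemma dotZr a x y : dot x (a *: y) = a^* * dot x y.
Proof. by rewrite (dotC ip) dotZl rmorphM /= -!(dotC ip). Qed.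

Lemma dotNr x y : dot x (- y) = - dot x y.
Proof. by rewrite (dotC ip) dotNl rmorphN /= -!(dotC ip). Qed.

Lemma dotBr x y z : dot x (y - z) = dot x y - dot x z.
Proof. by rewrite dotDr dotNr. Qed.

Lemma dot_inj x y : (forall z, dot x z = dot y z) -> x = y.
Proof.
move=> xy; apply/eqP; rewrite -subr_eq0; apply/eqP/(dot_eq0 ip).
by rewrite dotBl xy subrr.
Qed.

Lemma sqnormN x : sqnorm (- x) = sqnorm x.
Proof. by rewrite /sqnorm dotNl dotNr opprK. Qed.

Lemma parallelogram x y :
  sqnorm (x + y) + sqnorm (x - y) = 2 * (sqnorm x + sqnorm y).
Proof.
rewrite /sqnorm !(dotDl, dotDr, dotNl, dotNr) !ReD.
by case: (dot x x) (dot x y) (dot y x) (dot y y)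
  => [? ?] [? ?] [? ?] [? ?] /=; ring.
Qed.

Lemma sqnormD x y : sqnorm (x + y) <= 2 * (sqnorm x + sqnorm y).
Proof. by rewrite -parallelogram lerDl sqnorm_ge0. Qed.

Lemma sqnormZ a x : sqnorm (a *: x) = normsq a * sqnorm x.
Proof.
rewrite /sqnorm dotZl dotZr mulrA mul_conjC sqnormE.
by rewrite /= mul0r subr0.
Qed.

Lemma sqnorm_pythagoras x y :
  dot x y = 0 -> sqnorm (x + y) = sqnorm x + sqnorm y.
Proof.
move=> xy; rewrite /sqnorm dotDl !dotDr xy (dotC ip x y) xy conjC0 addr0 add0r.
by rewrite ReD.
Qed.

(** The deviation of [u] from orthogonality to [w] measures how much [u] can
    be shortened along [w]: the optimal multiple of [w] shortens the square of
    the norm by |<u, w>|^2 / |w|^2.  With [e = sqnorm u] this is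
    Cauchy-Schwarz. *)
Lemma dot_almost_minimal (u w : H) (e : R) :
  (forall t, sqnorm u <= sqnorm (u - t *: w) + e) ->
  normsq (dot u w) <= e * sqnorm w.
Proof.
move=> umin; have [w0|w0] := eqVneq (sqnorm w) 0.
  rewrite (sqnorm_eq0 w0) (dotC ip) dot0l conjC0 /normsq /= /sqnorm dot0l /=.
  by rewrite expr0n /= addr0 mulr0.
have w_gt0 : 0 < sqnorm w by rewrite lt0r w0 sqnorm_ge0.
set c := dot u w; pose t : R[i] := ((sqnorm w)^-1)%:C%C * c.
have := umin t.
suff -> : sqnorm (u - t *: w) = sqnorm u - normsq c / sqnorm w.
  rewrite -addrA lerDl -ler_pdivrMr// => ?; lra.
rewrite /sqnorm !(dotBl, dotBr, dotZl, dotZr) -/c sqnormE (sqnormE w).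
rewrite (dotC ip u w) -/c /t /normsq; move: (sqnorm u) => p.
case: (c) => a b; move: (sqnorm w) w0 => q q0; rewrite /= !(mul0r, subr0).
by field.
Qed.

Lemma cauchy_schwarz x y : normsq (dot x y) <= sqnorm x * sqnorm y.
Proof. by apply: dot_almost_minimal => t; rewrite lerDr sqnorm_ge0. Qed.

(** Completeness and closedness are tested on sequences whose steps decrease
    geometrically; every Cauchy sequence has such a subsequence. *)
Definition complete_ip : Prop := forall u : nat -> H,
  (forall n m, (n <= m)%N -> sqnorm (u m - u n) <= 4^-1 ^+ n) ->
  exists x, exists2 C, 0 <= C & forall n, sqnorm (x - u n) <= C * 4^-1 ^+ n.

Definition closed_ip (W : {pred H}) : Prop := forall (u : nat -> H) x C,
  0 <= C -> (forall n, u n \in W) ->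
  (forall n, sqnorm (x - u n) <= C * 4^-1 ^+ n) -> x \in W.

(** A minimising sequence for the distance from [x] to [W] is Cauchy by the
    parallelogram identity, and its limit is the projection because
    almost-minimisers are almost orthogonal. *)
Theorem projection_exists (W : submodClosed H) (x : H) :
  complete_ip -> closed_ip W ->
  exists2 y, y \in W & forall w, w \in W -> dot (x - y) w = 0.
Proof.
move=> cpl clo.
pose D := [set sqnorm (x - w) | w in [set w | w \in W]].
have infD : has_inf D.
  split; first by exists (sqnorm (x - 0)), 0 => //=; exact: rpred0.
  by exists 0 => _ [w _ <-]; exact: sqnorm_ge0.
have dmin w : w \in W -> inf D <= sqnorm (x - w).
  by move=> Ww; apply: ge_inf; [case: infD|exists w].
have eps n : 0 < 4^-1 * 4^-1 ^+ n :> R by rewrite mulr_gt0 ?exprn_gt0 ?invr_gt0.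
(* The error 4^-1 ^+ n / 4 absorbs the factor 4 of the parallelogram identity. *)
have [u uP] : {u : nat -> H & forall n,
    u n \in W /\ sqnorm (x - u n) < inf D + 4^-1 * 4^-1 ^+ n}.
  apply: (@choice _ _ (fun n w => w \in W /\
    sqnorm (x - w) < inf D + 4^-1 * 4^-1 ^+ n)) => n.
  by have [_ [w Ww <-] wlt] := inf_adherent (eps n) infD; exists w.
have uW n : u n \in W by case: (uP n).
have [|y [C C0 uy]] := cpl u.
  move=> n m nm.
  have mid : 2^-1 *: (u n + u m) \in W by rewrite rpredZ ?rpredD.
  have := parallelogram (x - u n) (x - u m).
  have -> : x - u n + (x - u m) = 2 *: (x - 2^-1 *: (u n + u m)).
    rewrite scalerBr scalerA mulfV ?pnatr_eq0// scale1r scaler_nat mulr2n.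
    by rewrite opprD addrACA.
  rewrite sqnormZ.
  have -> : normsq (2 : R[i]) = 4.
    by rewrite /normsq /= addr0 expr0n /= addr0; ring.
  have -> : x - u n - (x - u m) = u m - u n.
    by rewrite opprB addrC addrA subrK.
  have := dmin _ mid; have [_ un] := uP n; have [_ um] := uP m.
  have : 4^-1 ^+ m <= 4^-1 ^+ n :> R.
    by rewrite ler_wiXn2l ?invr_ge0// invf_le1 ?ler1n.
  move: un um; set a := 4^-1 ^+ n; set b := 4^-1 ^+ m.
  by move=> ? ? ? ? ?; lra.
exists y; first exact: (clo u _ C).
move=> w Ww; apply: normsq_eq0; apply/eqP; rewrite eq_le normsq_ge0 andbT.
apply: (@geometric_le0 _ _ (2 * (4^-1 * sqnorm w + C * sqnorm w))).
  by rewrite mulr_ge0// addr_ge0// mulr_ge0// ?invr_ge0 ?sqnorm_ge0.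
move=> n; rewrite -(subrK (u n) x) -addrA dotDl.
apply: (le_trans (normsqD _ _)); rewrite -mulrA ler_wpM2l// mulrDl lerD//.
  rewrite mulrAC; apply: dot_almost_minimal => t.
  rewrite -addrA -opprD.
  have [_ /ltW xu] := uP n; apply: (le_trans xu); rewrite lerD2r.
  by apply: dmin; rewrite rpredD ?rpredZ.
rewrite mulrAC; apply: (le_trans (cauchy_schwarz _ _)).
by rewrite ler_wpM2r ?sqnorm_ge0// -sqnormN opprB.
Qed.

(** By Cauchy-Schwarz the inner product with [e] is continuous. *)
Lemma orthogonal_closed (u : nat -> H) (x e : H) (C : R) : 0 <= C ->
  (forall n, dot (u n) e = 0) ->
  (forall n, sqnorm (x - u n) <= C * 4^-1 ^+ n) -> dot x e = 0.
Proof.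
move=> C0 ue xu; apply: normsq_eq0; apply/eqP; rewrite eq_le normsq_ge0 andbT.
apply: (@geometric_le0 _ _ (C * sqnorm e)).
  by rewrite mulr_ge0// ?sqnorm_ge0.
move=> n; rewrite -(subrK (u n) x) dotDl ue addr0 mulrAC.
by apply: (le_trans (cauchy_schwarz _ _)); rewrite ler_wpM2r ?sqnorm_ge0.
Qed.

End InnerProduct.

Section SumInnerProduct.
Context {R : realType} {H : lmodType R[i]}.
Variable dot : H -> H -> R[i].
Hypothesis ip : inner_product dot.

Lemma inner_product_sum : inner_product (sum_dot dot).
Proof.
split=> [a x y z|x y|x|[x y]]; rewrite /sum_dot /=.
- by rewrite !(dotPl ip) mulrDr addrACA.
- by rewrite rmorphD /= -!(dotC ip).
- by rewrite addr_ge0// (dot_ge0 ip).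
- move/eqP; rewrite paddr_eq0 ?(dot_ge0 ip)// => /andP[/eqP x0 /eqP y0].
  by congr pair; apply: (dot_eq0 ip).
Qed.

Lemma sqnorm_sum x : sqnorm (sum_dot dot) x = sqnorm dot x.1 + sqnorm dot x.2.
Proof. by rewrite /sqnorm ReD. Qed.

(** The matrix (1, 1; 1, -1) / sqrt 2 is real, symmetric and orthogonal, so it
    commutes with antilinear maps and squares to 1. *)
Lemma conjugation_block (K : H -> H) : conjugation dot K ->
  conjugation (sum_dot dot)
    (fun h => (sqrtC 2)^-1 *: operator_mx2 K K K (fun f => - K f) h).
Proof.
set r : R[i] := (sqrtC 2)^-1 => -[Kanti KK Kdot].
have rC : r^* = r by apply: CrealP; rewrite ger0_real// invr_ge0 sqrtC_ge0.
have rr : r * r = 2^-1 by rewrite -invfM -expr2 sqrtCK.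
have KD x y : K (x + y) = K x + K y.
  by rewrite -[x in LHS]scale1r Kanti conjC1 scale1r.
have K0 : K 0 = 0.
  by have /esym/eqP := KD 0 0; rewrite addr0 -subr_eq0 addrK => /eqP.
have KZ a x : K (a *: x) = a^* *: K x.
  by rewrite -[a *: x in LHS]addr0 Kanti K0 addr0.
have KN x : K (- x) = - K x by rewrite -scaleN1r KZ rmorphN rmorph1 scaleN1r.
have two (x : H) : 2^-1 *: (x + x) = x.
  by rewrite -mulr2n -[x *+ 2]scaler_nat scalerA mulVf ?pnatr_eq0// scale1r.
split=> [a x y|[x y]|x y].
- rewrite /operator_mx2 /= !Kanti; congr pair => /=.
    by rewrite addrACA -scalerDr [LHS]scalerDr !scalerA mulrC.
  by rewrite opprD -scalerN addrACA -scalerDr [LHS]scalerDr !scalerA mulrC.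
- rewrite /operator_mx2 /=; congr pair; rewrite /= !KZ rC !(KD, KN) !KK.
    by rewrite -scalerDr addrACA subrr addr0 scalerA rr two.
  rewrite -scalerN opprD opprK -scalerDr addrACA subrr add0r scalerA rr two//.
- rewrite /sum_dot /operator_mx2 /=.
  rewrite !(dotZl ip, dotZr ip) !(dotDl ip, dotDr ip, dotNl ip, dotNr ip).
  rewrite rC !Kdot.
  move: (dot y.1 x.1) (dot y.1 x.2) (dot y.2 x.1) (dot y.2 x.2) => a b c d.
  rewrite !mulrA rr -mulrDr.
  rewrite (_ : _ + (_ + _) = 2 * (a + d)); last by ring.
  by rewrite mulrA mulVf ?pnatr_eq0// mul1r.
Qed.

End SumInnerProduct.

Section ComplexSymmetric.
Context {R : realType} {H : lmodType R[i]}.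
Variable dot : H -> H -> R[i].

(** If the form <T h, k> is invariant under exchanging and conjugating its
    arguments, then [K T K] is the adjoint of [T]. *)
Lemma complex_symmetric_form (T K : H -> H) :
  bounded_operator dot T -> conjugation dot K ->
  complex_symmetric dot T K <->
  forall h k, dot (T h) k = dot (T (K k)) (K h).
Proof.
move=> Tb Kc; have [_ KK Kdot] := Kc; split=> [[_ _ [Ts adj TE]] h k|sym].
  by rewrite [in LHS]TE /= -[k in LHS]KK Kdot -adj.
split=> //; exists (K \o T \o K); last by apply/funext => x /=; rewrite !KK.
by move=> x y; rewrite sym -[K x in LHS]KK -[T _ in LHS]KK Kdot KK.
Qed.

End ComplexSymmetric.

(** * Completeness of spaces of square integrable functions *)

Section RieszFischer.
Context d (T : measurableType d) (R : realType).
Variable mu : {measure set T -> \bar R}.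

Lemma sum_half_pow_le2 n : \sum_(0 <= k < n) 2^-1 ^+ k <= 2 :> R.
Proof.
suff -> : \sum_(0 <= k < n) 2^-1 ^+ k = 2 - 2 * 2^-1 ^+ n :> R.
  by rewrite gerBl mulr_ge0// exprn_ge0// invr_ge0.
elim: n => [|n IHn]; first by rewrite big_geq// expr0 mulr1 subrr.
rewrite big_nat_recr//= IHn exprS; set a := 2^-1 ^+ n.
by rewrite mulrA mulfV ?pnatr_eq0// mul1r; lra.
Qed.

(** The sum of the series has a finite integral, hence is finite almost
    everywhere. *)
Lemma ae_cvg_series (v : nat -> T -> R) (K : R) :
  (forall n, measurable_fun setT (v n)) -> (forall n t, 0 <= v n t) ->
  (forall n, (\int[mu]_t (v n t)%:E <= (K * 2^-1 ^+ n)%:E)%E) ->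
  {ae mu, forall t, cvgn (series (v^~ t))}.
Proof.
move=> mv v0 intv.
have mev n : measurable_fun setT (fun t => (v n t)%:E) by exact/measurable_EFinP.
have K0 : 0 <= K.
  have := intv 0%N; rewrite expr0 mulr1 -lee_fin; apply: le_trans.
  by apply: integral_ge0 => t _; rewrite lee_fin.
have sum_fin : mu.-integrable setT (fun t => (\sum_(n <oo) (v n t)%:E)%E).
  apply/integrableP; split.
    by apply: ge0_emeasurable_sum => // n t _; rewrite lee_fin.
  under eq_integral => t _.
    rewrite gee0_abs; last by apply: nneseries_ge0 => n _ _; rewrite lee_fin.
    over.
  rewrite integral_nneseries//; last by move=> n t _; rewrite lee_fin.
  apply: (@le_lt_trans _ _ (K * 2)%:E); last exact: ltry.
  apply: lime_le.
    apply: is_cvg_nneseries => n _ _.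
    by apply: integral_ge0 => t _; rewrite lee_fin.
  apply: nearW => n.
  apply: (@le_trans _ _ (\sum_(0 <= k < n) (K * 2^-1 ^+ k)%:E)%E).
    exact: lee_sum.
  rewrite sumEFin lee_fin -mulr_sumr ler_wpM2l//; exact: sum_half_pow_le2.
have := integrable_ae measurableT sum_fin.
apply: (@filterS _ _ (ae_filter_ringOfSetsType mu)) => t /(_ I) tfin.
apply: nondecreasing_is_cvgn.
  apply/nondecreasing_seqP => n; rewrite !seriesEnat /= big_nat_recr//=.
  by rewrite lerDl.
exists (fine (\sum_(n <oo) (v n t)%:E)%E) => _ [n _ <-].
rewrite -lee_fin fineK// seriesEnat /= -sumEFin.
by apply: nneseries_lim_ge => k _ _; rewrite lee_fin.
Qed.

(** As [mu] is finite, the norms of the steps in L^1 decrease geometrically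
    too, so the sequence converges almost everywhere, and Fatou's lemma carries
    the estimates to the limit.  The limit is given by a formula in the values
    [u n t]: if every [u n] factors through one map, so does the limit. *)
Lemma riesz_fischer (u : nat -> T -> R) (C : R) :
  mu setT \is a fin_num ->
  (forall n, measurable_fun setT (u n)) ->
  (forall n m, (n <= m)%N ->
    (\int[mu]_t ((u m t - u n t) ^+ 2)%:E <= (C * 4^-1 ^+ n)%:E)%E) ->
  let f t := fine (limn_esup (fun n => (u n t)%:E)) in
  measurable_fun setT f /\
  forall n, (\int[mu]_t ((f t - u n t) ^+ 2)%:E <= (C * 4^-1 ^+ n)%:E)%E.
Proof.
move=> muT mu_ uC f.
have mf : measurable_fun setT f.
  apply: measurableT_comp; first exact: fine_measurable.
  by apply: measurable_fun_limn_esup => n; exact/measurable_EFinP.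
split=> // n.
have mdiff m : measurable_fun setT (fun t => (u m t - u n t) ^+ 2).
  by apply: measurable_funX; exact: measurable_funB.
(* With b = 2^-1 ^+ k and a the size of the k-th step, both terms on the right
   have geometrically decreasing integrals. *)
have pw (a b : R) : 0 <= a -> 0 < b -> a <= b + b^-1 * a ^+ 2.
  move=> a0 b0; have : 0 <= (a - b) ^+ 2 by exact: sqr_ge0.
  move=> ab; rewrite -subr_ge0.
  have -> : b + b^-1 * a ^+ 2 - a = b^-1 * ((a - b) ^+ 2 + a * b).
    by field; rewrite gt_eqF.
  rewrite mulr_ge0 ?invr_ge0 ?addr_ge0 ?sqr_ge0 ?mulr_ge0// ?ltW//.
have cvgu : {ae mu, forall t, cvgn (u^~ t)}.
  suff : {ae mu, forall t, cvgn (series (fun k => `|u k.+1 t - u k t|))}.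
    apply: (@filterS _ _ (ae_filter_ringOfSetsType mu)) => t ct.
    have /normed_cvg : cvgn [normed series (telescope (u^~ t))] by exact: ct.
    rewrite telescopeK => cv.
    have -> : u^~ t = (fun k => u k t - u 0%N t) + cst (u 0%N t).
      by apply/funext => k; rewrite fctE /= subrK.
    by apply: is_cvgD => //; exact: is_cvg_cst.
  apply: (@ae_cvg_series _ (fine (mu setT) + C)) => //.
    by move=> k; apply: measurableT_comp => //; exact: measurable_funB.
  move=> k.
  have pk : 0 < 2^-1 ^+ k :> R by rewrite exprn_gt0.
  have msq : measurable_fun setT (fun t => ((u k.+1 t - u k t) ^+ 2)%:E).
    by apply/measurable_EFinP; apply: measurable_funX; exact: measurable_funB.
  apply: (@le_trans _ _ (\int[mu]_t ((2^-1 ^+ k)%:E +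
     (2^-1 ^+ k)^-1%:E * ((u k.+1 t - u k t) ^+ 2)%:E))%E).
    apply: ge0_le_integral => //.
    - apply/measurable_EFinP; apply: measurableT_comp => //.
      exact: measurable_funB.
    - by apply: emeasurable_funD => //; exact: measurable_funeM.
    - move=> t _; rewrite lee_fin -(real_normK (num_real (u k.+1 t - u k t))).
      exact: pw.
  rewrite ge0_integralD//; first last.
  - exact: measurable_funeM.
  - by move=> t _; rewrite lee_fin mulr_ge0 ?sqr_ge0 ?invr_ge0 ?ltW.
  rewrite integral_cst//= ge0_integralZl_EFin//; first last.
  - by move=> t _; rewrite lee_fin sqr_ge0.
  rewrite mulrDl EFinD; apply: leeD.
    by rewrite muleC -[X in (X * _)%E]fineK.
  apply: (@le_trans _ _ ((2^-1 ^+ k)^-1%:E * (C * 4^-1 ^+ k)%:E)%E).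
    by rewrite lee_pmul2l ?uC// ?fin_num_abs//= lte_fin invr_gt0.
  rewrite -EFinM lee_fin le_eqVlt; apply/orP; left; apply/eqP.
  have -> : (4^-1 : R) = 2^-1 * 2^-1 by rewrite -invfM -natrM.
  by rewrite exprMn mulrCA mulKf// gt_eqF.
apply: (@le_trans _ _
  (\int[mu]_t limn_einf (fun m => ((u m t - u n t) ^+ 2)%:E))%E).
  rewrite le_eqVlt; apply/orP; left; apply/eqP; apply: ae_eq_integral => //.
  - by apply/measurable_EFinP; apply: measurable_funX; exact: measurable_funB.
  - rewrite (_ : (fun t => _) =
        fun t => - limn_esup (fun m => - ((u m t - u n t) ^+ 2)%:E))%E.
      apply: measurableT_comp => //; apply: measurable_fun_limn_esup => m.
      by apply: measurableT_comp => //; exact/measurable_EFinP.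
    by apply/funext => t; rewrite limn_esupN oppeK.
  - move: cvgu; apply: (@filterS _ _ (ae_filter_ringOfSetsType mu)) => t ct _ /=.
    have uE : (u m t)%:E @[m --> \oo] --> (limn (u^~ t))%:E.
      by apply: cvg_EFin => //; exact: nearW.
    have fE : f t = limn (u^~ t) by rewrite /f (cvg_limn_einf_sup uE).2.
    have sqE : ((u m t - u n t) ^+ 2)%:E @[m --> \oo] --> ((f t - u n t) ^+ 2)%:E.
      apply: cvg_EFin; first exact: nearW.
      rewrite fE.
      apply: (@cvg_comp _ _ _ (fun m => u m t - u n t) (fun x : R => x ^+ 2) _
        (nbhs (limn (u^~ t) - u n t))).
        by apply: cvgB => //; exact: cvg_cst.
      exact: exprn_continuous.
    by rewrite (cvg_limn_einf_sup sqE).1.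
apply: (le_trans (fatou _ _ _ _)) => //.
- by move=> m; exact/measurable_EFinP.
- by move=> m t _; rewrite lee_fin sqr_ge0.
rewrite limn_einf_lim; apply: lime_le.
  exact: is_cvg_einfs.
apply: nearW => m; apply: ereal_inf_le.
exists (\int[mu]_t ((u (maxn m n) t - u n t) ^+ 2)%:E)%E; last first.
  by apply: uC; rewrite leq_maxr.
by exists (maxn m n) => //=; rewrite leq_maxl.
Qed.

End RieszFischer.

(** * Functions of finite p-norm *)

Section Lfun.
Context d (T : measurableType d) (R : realType).
Variable mu : {measure set T -> \bar R}.
Implicit Types (f g : T -> R) (r : R).

Lemma Lfun_measurable f p : f \in Lfun mu p -> measurable_fun setT f.
Proof. by rewrite inE => /andP[/[!inE]]. Qed.

Lemma measurable_powR_norm f r :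
  measurable_fun setT f -> measurable_fun setT (fun t => `|f t| `^ r).
Proof.
move=> mf; apply: (@measurableT_comp _ _ _ _ _ _ (@powR R ^~ r)) => //.
exact: measurableT_comp.
Qed.

Lemma LfunP_fin f r : 1 <= r ->
  f \in Lfun mu r%:E <-> measurable_fun setT f /\
    (\int[mu]_t (`|f t| `^ r)%:E < +oo)%E.
Proof.
move=> r1; split=> [fL|[mf fi]].
  split; first exact: Lfun_measurable fL.
  have := integrable_lty measurableT (Lfun_integrable r1 fL); exact.
rewrite inE; apply/andP; split; rewrite inE//=.
by rewrite /finite_norm unlock /Lnorm poweR_lty.
Qed.

Lemma LfunP_oo f :
  f \in Lfun mu +oo%E <-> measurable_fun setT f /\
    exists M, {ae mu, forall t, `|f t| <= M}.
Proof.
split=> [|[mf [M fM]]].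
  rewrite inE => /andP[/[1!inE]/= mf].
  rewrite inE/= /finite_norm unlock /Lnorm; case: ifPn => [_|mu0 _].
    by move=> /ess_supr_bounded[M fM]; split=> //; exists M.
  split=> //; exists 0; exists setT; split => //.
  by apply/eqP; rewrite eq_le measure_ge0 andbT leNgt.
rewrite inE; apply/andP; split; rewrite inE//= /finite_norm unlock /Lnorm.
case: ifP => // _; apply: (@le_lt_trans _ _ M%:E); last exact: ltry.
apply/ess_supP; apply: (@filterS _ _ (ae_filter_ringOfSetsType mu)) fM => t /=.
by rewrite lee_fin.
Qed.

Lemma Lfun_mul_Loo f g r : 1 <= r ->
  f \in Lfun mu r%:E -> g \in Lfun mu +oo%E -> f \* g \in Lfun mu r%:E.
Proof.
move=> r1 /[dup] fL /(LfunP_fin _ r1)[mf fi] /LfunP_oo[mg [M gM]].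
apply/(LfunP_fin _ r1); split; first exact: measurable_funM.
have fi' := Lfun_integrable r1 fL.
apply: (@le_lt_trans _ _ (\int[mu]_t ((`|M| `^ r)%:E * (`|f t| `^ r)%:E))%E).
  apply: ae_ge0_le_integral => //.
  - by apply/measurable_EFinP/measurable_powR_norm; exact: measurable_funM.
  - by apply: measurable_funeM; apply/measurable_EFinP/measurable_powR_norm.
  - apply: (@filterS _ _ (ae_filter_ringOfSetsType mu)) gM => t gM _.
    rewrite -EFinM lee_fin normrM powRM// mulrC ler_wpM2r ?powR_ge0//.
    have r0 : 0 <= r by rewrite (le_trans _ r1).
    by apply: ge0_ler_powR; rewrite ?nnegrE// (le_trans gM)// ler_norm.
by have := integrable_lty measurableT (integrableZl measurableT (`|M| `^ r) fi').
Qed.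

End Lfun.

(** * Reflections of the circle *)

Section ArcReflection.
Variable R : realType.
Local Notation arc := (@arc_length R).

(** The reflection [t |-> s - t] of the circle, brought back to [[0, 2 pi]]. *)
Definition arc_reflect (s t : R) : R :=
  if t <= s then s - t else s - t + pi *+ 2.

Lemma cis_arc_reflect s t : cis (arc_reflect s t) = cis s * (cis t)^*.
Proof.
have -> : cis (arc_reflect s t) = cis (s - t).
  rewrite /arc_reflect; case: ifP => // _.
  by rewrite /cis cosD2pi sinD2pi.
rewrite /cis cosB sinB; apply/eqP; rewrite eq_complex /=.
by apply/andP; split; apply/eqP; ring.
Qed.

Lemma measurable_arc_reflect s : measurable_fun setT (arc_reflect s).
Proof.
apply: measurable_fun_ifT.
- by apply: measurable_fun_ler.
- by apply: measurable_funB.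
- by apply: measurable_funD => //; apply: measurable_funB.
Qed.

Lemma twopi_ge0 : 0 <= pi *+ 2 :> R.
Proof. by rewrite mulrn_wge0// pi_ge0. Qed.

Lemma arc_lengthT : arc setT = (pi *+ 2)%:E.
Proof.
rewrite /= /mrestr setTI lebesgue_measure_itv /= lte_fin.
by case: ltgtP (twopi_ge0) => // [_ _|<-]; rewrite ?oppr0 ?adde0 ?subr0.
Qed.

Lemma arc_length_fin : arc setT \is a fin_num.
Proof. by rewrite arc_lengthT. Qed.

Lemma lebesgue_measure_oc (a b : R) : a <= b ->
  lebesgue_measure (`]a, b] : set R) = (b - a)%:E.
Proof.
move=> ab; rewrite lebesgue_measure_itv /= lte_fin; case: ltP => // ba.
by rewrite (@le_anti _ _ a b) ?ab// subrr.
Qed.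

(** Both sides are finite measures, so it is enough to compare them on the
    half-lines, where each preimage is an interval or two. *)
Lemma arc_length_reflect (s : R) (A : set R) : 0 <= s <= pi *+ 2 ->
  measurable A -> arc (arc_reflect s @^-1` A) = arc A.
Proof.
move=> /andP[s0 s2pi] mA; set p := pi *+ 2 in s2pi *.
have mr := measurable_arc_reflect s.
pose m2 : {measure set (measurableTypeR R) -> \bar R} :=
  pushforward arc (arc_reflect s : measurableTypeR R -> measurableTypeR R).
suff : arc A = m2 mr A by move=> ->.
apply: (@measure_unique _ R (measurableTypeR R) (@RGenInftyO.G R)
  (fun k => `]-oo, k%:R[%classic) _ _ _ _ arc (m2 mr) _ _ A mA).
- exact: RGenInftyO.measurableE.
- move=> _ _ [x ->] [y ->]; exists (Num.min x y).
  by apply/seteqP; split=> t /=; rewrite !in_itv /= lt_min => /andP.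
- by move=> i; exists i%:R.
- apply/seteqP; split=> // t _; exists (Num.truncn `|t|).+1 => //=.
  by rewrite in_itv /= (le_lt_trans (ler_norm t))// truncnS_gt.
- move=> _ [x ->]; rewrite /m2 /= /pushforward /mrestr -/p.
  have r_itv t : 0 <= t <= p -> 0 <= arc_reflect s t <= p.
    by rewrite /arc_reflect -/p => /andP[? ?]; case: (leP t s) => ?; lra.
  have [x0|x0] := leP x 0.
    congr (lebesgue_measure _); apply/seteqP; split=> t /=; rewrite !in_itv /=.
      by move=> [? ?]; lra.
    by move=> [? /r_itv]; lra.
  have [xp|xp] := ltP p x.
    congr (lebesgue_measure _); apply/seteqP; split=> t /=; rewrite !in_itv /=.
      by move=> [? /[dup] ? /r_itv]; split=> //; lra.
    by move=> [? ?]; split=> //; lra.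
  rewrite (_ : _ `&` _ = `[0, x[%classic); last first.
    apply/seteqP; split=> t /=; rewrite !in_itv /=; first by move=> [? ?]; lra.
    by move=> ?; split; lra.
  rewrite lebesgue_measure_itv /= lte_fin x0 sube0.
  have [xs|xs] := leP x s.
    rewrite (_ : _ `&` _ = `]s - x, s]%classic); last first.
      apply/seteqP; split=> t /=; rewrite !in_itv /= /arc_reflect -/p.
        by move=> [+ ?]; case: (leP t s) => ? ?; lra.
      by move=> ?; case: (leP t s) => ?; split; lra.
    by rewrite lebesgue_measure_oc; [congr EFin; lra|lra].
  rewrite (_ : _ `&` _ = `[0, s] `|` `]s + p - x, p])%classic; last first.
    apply/seteqP; split=> t /=; rewrite !in_itv /= /arc_reflect -/p.
      by move=> [+ ?]; case: (leP t s) => ? ?; [left|right]; lra.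
    by move=> [?|?]; case: (leP t s) => ?; split; lra.
  pose I1 : set R := `[0, s]%classic; pose I2 : set R := `]s + p - x, p]%classic.
  rewrite -/I1 -/I2.
  have -> : lebesgue_measure (I1 `|` I2) =
      (lebesgue_measure I1 + lebesgue_measure I2)%E.
    apply: measureU; [exact: measurable_itv|exact: measurable_itv|].
    apply/seteqP; split=> t //=.
    by rewrite /I1 /I2 /= !in_itv /= => -[? ?]; lra.
  rewrite lebesgue_measure_oc; last by lra.
  have -> : lebesgue_measure I1 = s%:E.
    rewrite lebesgue_measure_itv /= lte_fin.
    case: ltP => [_|sle0]; first by rewrite sube0.
    by rewrite (@le_anti _ _ s 0) ?s0 ?sle0.
  by rewrite -EFinD; congr EFin; lra.
- move=> k; apply: (@le_lt_trans _ _ (arc setT)); last by rewrite arc_lengthT ltry.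
  by apply: le_measure => //; rewrite inE.
Qed.

Lemma ae_arc_reflect (s : R) (P : R -> Prop) : 0 <= s <= pi *+ 2 ->
  {ae arc, forall t, P t} -> {ae arc, forall t, P (arc_reflect s t)}.
Proof.
move=> s2pi [N [mN N0 PN]]; exists (arc_reflect s @^-1` N); split.
- by rewrite -[X in measurable X]setTI; apply: measurable_arc_reflect.
- exact: etrans (arc_length_reflect s2pi mN) N0.
- by move=> t /= nP; apply: PN.
Qed.

Lemma ge0_integral_arc_reflect (s : R) (f : R -> \bar R) : 0 <= s <= pi *+ 2 ->
  measurable_fun setT f -> (forall t, 0 <= f t)%E ->
  (\int[arc]_t f (arc_reflect s t) = \int[arc]_t f t)%E.
Proof.
move=> s2pi mf f0; have mr := measurable_arc_reflect s.
rewrite -[LHS]/(\int[arc]_(t in arc_reflect s @^-1` setT) (f \o arc_reflect s) t)%E.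
rewrite -(@ge0_integral_pushforward _ _ (measurableTypeR R) (measurableTypeR R)
  R (arc_reflect s) mr arc setT f)//.
by apply: eq_measure_integral => A mA _; exact: arc_length_reflect.
Qed.

Lemma integral_arc_reflect (s : R) (f : R -> \bar R) : 0 <= s <= pi *+ 2 ->
  arc.-integrable setT f ->
  (\int[arc]_t f (arc_reflect s t) = \int[arc]_t f t)%E.
Proof.
move=> s2pi /integrableP[mf fi]; have mr := measurable_arc_reflect s.
rewrite -[LHS]/(\int[arc]_(t in arc_reflect s @^-1` setT) (f \o arc_reflect s) t)%E.
rewrite -(@integral_pushforward _ _ (measurableTypeR R) (measurableTypeR R)
  R (arc_reflect s) mr arc setT f)//.
  by apply: eq_measure_integral => A mA _; exact: arc_length_reflect.
apply/integrableP; split; first exact: measurableT_comp.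
rewrite preimage_setT (@ge0_integral_arc_reflect s (abse \o f))//.
  exact: measurableT_comp.
by move=> t; exact: abse_ge0.
Qed.

Lemma Lfun_arc_reflect s (u : R -> R) r : 0 <= s <= pi *+ 2 -> 1 <= r ->
  u \in Lfun arc r%:E -> u \o arc_reflect s \in Lfun arc r%:E.
Proof.
move=> s2pi r1 /(LfunP_fin _ _ r1)[mu_ ui]; apply/(LfunP_fin _ _ r1).
have mr := measurable_arc_reflect s.
split; first exact: measurableT_comp.
rewrite (@ge0_integral_arc_reflect s (fun t => (`|u t| `^ r)%:E))//.
  exact/measurable_EFinP/measurable_powR_norm.
Qed.

Lemma Loo_arc_reflect s (u : R -> R) : 0 <= s <= pi *+ 2 ->
  u \in Lfun arc +oo%E -> u \o arc_reflect s \in Lfun arc +oo%E.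
Proof.
move=> s2pi /LfunP_oo[mu_ [M uM]]; apply/LfunP_oo; split.
  by apply: measurableT_comp => //; exact: measurable_arc_reflect.
by exists M; apply: (ae_arc_reflect s2pi uM).
Qed.

Lemma unit_circle_cis (z : R[i]) : `|z| = 1 ->
  exists2 s, 0 <= s <= pi *+ 2 & z = cis s.
Proof.
case: z => a b /(congr1 (fun w => w ^+ 2)).
rewrite -add_Re2_Im2 /= expr1n => -[] ab.
have a1 : -1 <= a <= 1.
  rewrite -ler_norml -ler_sqr ?nnegrE// real_normK ?num_real// expr1n -ab.
  by rewrite lerDl sqr_ge0.
have sin_acos_a : sin (acos a) = `|b|.
  by rewrite sin_acos// (_ : 1 - a ^+ 2 = b ^+ 2) ?sqrtr_sqr//; lra.
have := acos_ge0 a1; have := acos_lepi a1 => acos_pi acos0.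
have pi0 := pi_ge0 R.
have [b0|b0] := leP 0 b.
  exists (acos a); first by rewrite acos0 (le_trans acos_pi)// mulr2n lerDl.
  by rewrite /cis acosK// sin_acos_a ger0_norm.
exists (pi *+ 2 - acos a); first by rewrite mulr2n; lra.
rewrite /cis cosB sinB cos2pi sin2pi !mul0r !mul1r addr0 sub0r acosK//.
by rewrite sin_acos_a ltr0_norm// opprK.
Qed.

End ArcReflection.

(** * Integration over the circle *)

Section CircleFunctions.
Variable R : realType.
Local Notation arc := (@arc_length R).
Implicit Types (f g phi : R[i] -> R[i]^o) (lambda : R[i]).

Lemma circle_LfunD p f g : (1 <= p)%E ->
  f \in circle_Lfun p -> g \in circle_Lfun p ->
  (fun z => f z + g z) \in circle_Lfun p.
Proof.
move=> p1 fL gL; have [_ /(_ 1 f g fL gL)] := @circle_Lfun_submod_closed R p p1.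
by rewrite scale1r.
Qed.

Lemma circle_LfunZ p a f : (1 <= p)%E ->
  f \in circle_Lfun p -> (fun z => a * f z) \in circle_Lfun p.
Proof.
move=> p1 fL; have [L0 /(_ a f 0 fL L0)] := @circle_Lfun_submod_closed R p p1.
by rewrite addr0.
Qed.

Lemma circle_LfunN p f : (1 <= p)%E ->
  f \in circle_Lfun p -> (fun z => - f z) \in circle_Lfun p.
Proof.
move=> p1 fL; rewrite (_ : (fun z => _) = fun z => -1 * f z).
  exact: circle_LfunZ.
by apply/funext => z; rewrite mulN1r.
Qed.

Lemma circle_LfunB p f g : (1 <= p)%E ->
  f \in circle_Lfun p -> g \in circle_Lfun p ->
  (fun z => f z - g z) \in circle_Lfun p.
Proof. by move=> p1 fL gL; apply: circle_LfunD => //; exact: circle_LfunN. Qed.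

Lemma eq_circle_int f g : (forall t, f (cis t) = g (cis t)) ->
  circle_int f = circle_int g.
Proof.
move=> fg; congr (_ * Complex _ _); apply: eq_Rintegral => t _; by rewrite fg.
Qed.

Lemma circle_Lfun_mul_Loo r phi f : 1 <= r -> phi \in Linfty R ->
  f \in circle_Lfun r%:E -> (fun z => phi z * f z) \in circle_Lfun r%:E.
Proof.
move=> r1 /andP[pr pi] /andP[fr fi].
have [_ LD] := @Lfun_submod_closed _ _ R arc r%:E r1.
apply/andP; split.
- rewrite (_ : (fun t => _) =
    -1 *: ((fun t => complex.Im (f (cis t))) \* (fun t => complex.Im (phi (cis t))))
    + ((fun t => complex.Re (f (cis t))) \* (fun t => complex.Re (phi (cis t)))));
    last first.
    apply/funext => t /=; rewrite !fctE scaleN1r addrC /=.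
    by case: (phi _) (f _) => [a b] [c d] /=; rewrite mulrC (mulrC b).
  by apply: LD; exact: Lfun_mul_Loo.
- rewrite (_ : (fun t => _) =
    1 *: ((fun t => complex.Im (f (cis t))) \* (fun t => complex.Re (phi (cis t))))
    + ((fun t => complex.Re (f (cis t))) \* (fun t => complex.Im (phi (cis t)))));
    last first.
    apply/funext => t /=; rewrite !fctE scale1r /=.
    by case: (phi _) (f _) => [a b] [c d] /=; rewrite mulrC (mulrC b).
  by apply: LD; exact: Lfun_mul_Loo.
Qed.

Lemma LinftyP f : f \in Linfty R <->
  [/\ measurable_fun setT (fun t => complex.Re (f (cis t)) : R),
      measurable_fun setT (fun t => complex.Im (f (cis t)) : R) &
      exists M, ae_circle (fun z => normsq (f z) <= M)].
Proof.
split=> [/andP[/LfunP_oo[mr [M rM]] /LfunP_oo[mi [N iN]]]|[mr mi [M fM]]].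
  split=> //; exists (M ^+ 2 + N ^+ 2).
  apply: (@filterS2 _ _ (ae_filter_ringOfSetsType arc)) rM iN => t rM iN.
  rewrite /normsq -(real_normK (num_real (complex.Re _))).
  rewrite -(real_normK (num_real (complex.Im _))).
  by rewrite lerD// ler_sqr ?nnegrE// (le_trans _ rM, le_trans _ iN).
have sq (a b c : R) : a ^+ 2 + b ^+ 2 <= c -> `|a| <= c + 1.
  move=> abc; rewrite ler_norml.
  have := sqr_ge0 b; have := sqr_ge0 (a - 1); have := sqr_ge0 (a + 1); nra.
apply/andP; split; apply/LfunP_oo; split=> //; exists (M + 1).
  by apply: (@filterS _ _ (ae_filter_ringOfSetsType arc)) fM => t; exact: sq.
apply: (@filterS _ _ (ae_filter_ringOfSetsType arc)) fM => t; rewrite /normsq addrC.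
exact: sq.
Qed.

Lemma Linfty_mul phi f : phi \in Linfty R -> f \in Linfty R ->
  (fun z => phi z * f z) \in Linfty R.
Proof.
move=> /LinftyP[pr pi [M pM]] /LinftyP[fr fi [N fN]]; apply/LinftyP; split.
- rewrite (_ : (fun t => _) = (fun t =>
    complex.Re (phi (cis t)) * complex.Re (f (cis t)) -
    complex.Im (phi (cis t)) * complex.Im (f (cis t)))).
    by apply: measurable_funB; exact: measurable_funM.
  by apply/funext => t; case: (phi _) (f _) => [a b] [].
- rewrite (_ : (fun t => _) = (fun t =>
    complex.Re (phi (cis t)) * complex.Im (f (cis t)) +
    complex.Im (phi (cis t)) * complex.Re (f (cis t)))).
    by apply: measurable_funD; exact: measurable_funM.
  by apply/funext => t; case: (phi _) (f _) => [a b] [].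
- exists (M * N); apply: ae_circleS2 pM fN => z pM fN; rewrite normsqM.
  by rewrite ler_pM ?normsq_ge0.
Qed.

Lemma Linfty_cst (a : R[i]) : (fun=> a) \in Linfty R.
Proof.
by apply/LinftyP; split=> //; exists (normsq a); exact: aeW.
Qed.

Lemma normsq_cis_zpow t n : normsq (cis t ^ n : R[i]) = 1.
Proof.
have c1 : normsq (cis t : R[i]) = 1 by rewrite /normsq /= cos2Dsin2.
have cX (z : R[i]) k : normsq z = 1 -> normsq (z ^+ k) = 1.
  move=> z1; elim: k => [|k IH]; last by rewrite exprS normsqM z1 mul1r.
  by rewrite expr0 /normsq /= expr0n addr0 expr1n.
case: n => n; first by rewrite -exprnP cX.
rewrite NegzE -exprnN -exprVn cX// cisV /normsq /= cosN sinN sqrrN.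
exact: cos2Dsin2.
Qed.

Lemma Linfty_zpow (n : int) : (fun z : R[i] => z ^ n) \in Linfty R.
Proof.
have /andP[/Lfun_measurable mr /Lfun_measurable mi] := circle_Lfun_zpow R n.
by apply/LinftyP; split=> //; exists 1; apply: aeW => t; rewrite normsq_cis_zpow.
Qed.

Lemma Linfty_subset (r : R) : 1 <= r -> {subset Linfty R <= circle_Lfun r%:E}.
Proof.
move=> r1 f /andP[fr fi]; apply/andP.
by split; apply: (Lfun_subset _ _ (arc_length_fin R) _ (q := +oo%E));
  rewrite ?leey.
Qed.

Lemma circle_Lfun2_1 : {subset circle_Lfun 2%:E <= @circle_Lfun R 1}.
Proof.
by move=> f /andP[fr fi]; apply/andP; split;
  apply: Lfun_subset12 => //; exact: arc_length_fin.
Qed.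

Lemma circle_intD f g : f \in circle_Lfun 1 -> g \in circle_Lfun 1 ->
  circle_int (fun z => f z + g z) = circle_int f + circle_int g.
Proof.
move=> fL gL; rewrite -[circle_int f]mul1r -circle_int_linear//.
by apply: eq_circle_int => t; rewrite scale1r.
Qed.

Lemma circle_intZ a f : f \in circle_Lfun 1 ->
  circle_int (fun z => a * f z) = a * circle_int f.
Proof.
move=> fL; have L0 : (0 : R[i] -> R[i]^o) \in circle_Lfun 1.
  by case: (@circle_Lfun_submod_closed R 1 (lexx _)).
have i0 : circle_int (0 : R[i] -> R[i]^o) = 0.
  have := circle_int_linear 1 L0 L0; rewrite scaler0 add0r mul1r.
  by move/eqP; rewrite -subr_eq0 opprD addrA subrr sub0r oppr_eq0 => /eqP.
have := circle_int_linear a fL L0; rewrite i0 !addr0 => <-.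
by apply: eq_circle_int => t.
Qed.

Lemma circle_intN f : f \in circle_Lfun 1 ->
  circle_int (fun z => - f z) = - circle_int f.
Proof.
move=> fL; rewrite -mulN1r -circle_intZ//.
by apply: eq_circle_int => t; rewrite mulN1r.
Qed.

Lemma circle_intB f g : f \in circle_Lfun 1 -> g \in circle_Lfun 1 ->
  circle_int (fun z => f z - g z) = circle_int f - circle_int g.
Proof.
by move=> fL gL; rewrite circle_intD ?circle_intN//; exact: circle_LfunN.
Qed.

Lemma circle_int_conj f : f \in circle_Lfun 1 ->
  circle_int (fun z => (f z)^*) = (circle_int f)^*.
Proof.
move=> /andP[_ /Lfun1_integrable fi].
rewrite /circle_int rmorphM /= -[X in _ = X * _]/((_%:C%C)^*%C) conjc_real.
congr (_ * _); rewrite /=; congr Complex.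
  by apply: eq_Rintegral => t _; case: (f _).
rewrite -mulN1r -RintegralZl//; apply: eq_Rintegral => t _.
by rewrite mulN1r; case: (f _).
Qed.

Lemma circle_int_ge0 f : (forall t, 0 <= f (cis t)) -> 0 <= circle_int f.
Proof.
move=> f0; rewrite /circle_int mulr_ge0//.
  by rewrite ler0c invr_ge0 twopi_ge0.
rewrite lecE /=; apply/andP; split; last first.
  by apply: Rintegral_ge0 => t _; have := f0 t; rewrite lecE => /andP[].
rewrite (@eq_Rintegral _ _ _ _ _ (cst 0)) ?Rintegral_cst ?mul0r//.
by move=> t _; rewrite /= (ger0_Im (f0 t)).
Qed.

Section Reflect.
Variable lambda : R[i].
Hypothesis lambda1 : `|lambda| = 1.

Let angle : {s : R | 0 <= s <= pi *+ 2 & lambda = cis s}.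
Proof. by apply: cid2; exact: unit_circle_cis. Qed.

Lemma ae_circle_reflect (P : R[i] -> Prop) :
  ae_circle P -> ae_circle (fun z => P (lambda * z^*)).
Proof.
have [s s2pi ->] := angle.
move/(ae_arc_reflect s2pi); apply: (@filterS _ _ (ae_filter_ringOfSetsType arc)).
by move=> t; rewrite cis_arc_reflect.
Qed.

Lemma circle_Lfun_reflect r f : 1 <= r ->
  f \in circle_Lfun r%:E -> (fun z => f (lambda * z^*)) \in circle_Lfun r%:E.
Proof.
have [s s2pi ->] := angle; move=> r1 /andP[fr fi]; apply/andP; split.
  rewrite (_ : (fun t => _) = (fun t => complex.Re (f (cis t))) \o arc_reflect s).
    exact: Lfun_arc_reflect.
  by apply/funext => t; rewrite /= cis_arc_reflect.
rewrite (_ : (fun t => _) = (fun t => complex.Im (f (cis t))) \o arc_reflect s).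
  exact: Lfun_arc_reflect.
by apply/funext => t; rewrite /= cis_arc_reflect.
Qed.

Lemma Linfty_reflect f :
  f \in Linfty R -> (fun z => f (lambda * z^*)) \in Linfty R.
Proof.
have [s s2pi ->] := angle; move=> /andP[fr fi]; apply/andP; split.
  rewrite (_ : (fun t => _) = (fun t => complex.Re (f (cis t))) \o arc_reflect s).
    exact: Loo_arc_reflect.
  by apply/funext => t; rewrite /= cis_arc_reflect.
rewrite (_ : (fun t => _) = (fun t => complex.Im (f (cis t))) \o arc_reflect s).
  exact: Loo_arc_reflect.
by apply/funext => t; rewrite /= cis_arc_reflect.
Qed.

Lemma circle_int_reflect f : f \in circle_Lfun 1 ->
  circle_int (fun z => f (lambda * z^*)) = circle_int f.
Proof.
have [s s2pi ->] := angle; move=> /andP[/Lfun1_integrable fr /Lfun1_integrable fi].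
congr (_ * Complex _ _); rewrite /Rintegral.
  rewrite -(integral_arc_reflect s2pi fr); congr fine.
  by apply: eq_integral => t _; rewrite /= cis_arc_reflect.
rewrite -(integral_arc_reflect s2pi fi); congr fine.
by apply: eq_integral => t _; rewrite /= cis_arc_reflect.
Qed.

Lemma reflect_involutive t : lambda * (lambda * (cis t)^*)^* = cis t.
Proof.
rewrite rmorphM /= conjCK mulrA.
have -> : lambda * lambda^* = 1 by rewrite -normCK lambda1 expr1n.
by rewrite mul1r.
Qed.

End Reflect.

End CircleFunctions.

(** * Uniqueness of Fourier coefficients *)

Section Sharpening.
Variable R : realType.
Implicit Types (x : R).

Lemma bernoulli_ineq (a : R) m : -1 <= a -> 1 + m%:R * a <= (1 + a) ^+ m.
Proof.
move=> a1; elim: m => [|m IHm]; first by rewrite mul0r addr0 expr0.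
have a0 : 0 <= 1 + a by lra.
rewrite exprSr; apply: le_trans (ler_wpM2r a0 IHm).
rewrite -natr1; have := sqr_ge0 a; have : 0 <= m%:R :> R by [].
by move: m%:R => k ? ?; nra.
Qed.

(** [sharpen n] is close to a step at 1/2: by Bernoulli's inequality it lies
    between [1 - (2 x)^n] and [(2 x)^-n]. *)
Definition sharpen n x : R := (1 - x ^+ n) ^+ (2 ^ n).

Lemma sharpen_itv n x : 0 <= x <= 1 -> 0 <= sharpen n x <= 1.
Proof.
move=> /andP[x0 x1]; have xn0 : 0 <= x ^+ n by rewrite exprn_ge0.
have xn1 : x ^+ n <= 1 by rewrite exprn_ile1.
by rewrite exprn_ge0 ?exprn_ile1 ?subr_ge0// gerBl.
Qed.

Lemma cvg_sharpen1 x : 0 <= x < 2^-1 -> sharpen n x @[n --> \oo] --> (1 : R).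
Proof.
move=> /andP[x0 x2].
apply: (@squeeze_cvgr _ _ _ _ (fun n => 1 - (2 * x) ^+ n) (cst 1)).
- apply: nearW => n; have [|_ ->] := andP (@sharpen_itv n x _); first lra.
  have xn1 : x ^+ n <= 1 by rewrite exprn_ile1//; lra.
  rewrite andbT /sharpen exprMn -natrX -mulrN.
  by apply: bernoulli_ineq; lra.
- rewrite -[X in _ --> X]subr0; apply: cvgB; first exact: cvg_cst.
  by apply: cvg_expr; rewrite ger0_norm; lra.
- exact: cvg_cst.
Qed.

Lemma cvg_sharpen0 x : 2^-1 < x <= 1 -> sharpen n x @[n --> \oo] --> (0 : R).
Proof.
move=> /andP[x2 x1].
apply: (@squeeze_cvgr _ _ _ _ (cst 0) (fun n => (2 * x)^-1 ^+ n)).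
- apply: nearW => n; have [|-> _] /= := andP (@sharpen_itv n x _); first lra.
  have x0 : 0 < (2 * x) ^+ n by rewrite exprn_gt0//; lra.
  have xn0 : 0 <= x ^+ n by rewrite exprn_ge0//; lra.
  have xn1 : x ^+ n <= 1 by rewrite exprn_ile1//; lra.
  rewrite exprVn -[leRHS]mul1r ler_pdivlMr//.
  have B : (2 * x) ^+ n <= (1 + x ^+ n) ^+ (2 ^ n).
    apply: le_trans (bernoulli_ineq _ _); last lra.
    by rewrite exprMn natrX lerDr.
  apply: (@le_trans _ _ (sharpen n x * (1 + x ^+ n) ^+ (2 ^ n))).
    by rewrite ler_wpM2l// /sharpen exprn_ge0// subr_ge0.
  rewrite /sharpen -exprMn exprn_ile1//.
    by rewrite mulr_ge0//; lra.
  by move: (x ^+ n) => a in xn0 xn1 *; nra.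
- exact: cvg_cst.
- apply: cvg_expr; rewrite ger0_norm ?invr_ge0; last lra.
  by rewrite invf_lt1; lra.
Qed.

End Sharpening.

Section Halflines.
Variable R : realType.
Variable mu : {measure set (measurableTypeR R) -> \bar R}.

(** The sets over which an integrable function integrates to 0 form a
    lambda-system, so half-lines suffice. *)
Lemma integral_halfline_eq0 (u : R -> R) : mu.-integrable setT (EFin \o u) ->
  (\int[mu]_t (u t)%:E = 0)%E ->
  (forall x, \int[mu]_(t in `]-oo, x[) (u t)%:E = 0)%E ->
  {ae mu, forall t, u t = 0}.
Proof.
move=> ui uT uh.
have key (A : set (measurableTypeR R)) : measurable A ->
    (\int[mu]_(t in A) (u t)%:E = 0)%E.
  move=> mA; have := mA; rewrite [X in X A -> _](@RGenInftyO.measurableE R).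
  apply: (@dynkin_induction _ (measurableTypeR R) (@RGenInftyO.G R)
    (fun A => \int[mu]_(t in A) (u t)%:E = 0)%E).
  - exact: RGenInftyO.measurableE.
  - move=> _ _ [x ->] [y ->]; exists (Num.min x y).
    by apply/seteqP; split=> t /=; rewrite !in_itv /= lt_min => /andP.
  - exact: uT.
  - by move=> _ [x ->]; exact: uh.
  - move=> S mS S0; have := uT; rewrite -(setUv S) integral_setU//.
    + by rewrite S0 add0e.
    + exact: measurableC.
    + by rewrite setUv; exact: measurable_int ui.
    + by rewrite disj_set2E setICr.
  - move=> F mF tF F0; rewrite integral_bigcup//.
      by apply: eseries0 => n _ _; exact: F0.
    apply: integrableS ui => //; exact: bigcup_measurable.
have : ae_eq mu setT (EFin \o u) (cst 0%E).
  apply: integral_ae_eq => // E _ mE; rewrite integral0.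
  exact: key.
apply: (@filterS _ _ (ae_filter_ringOfSetsType mu)) => t /(_ I) /=.
by case.
Qed.

End Halflines.

Section FourierUniqueness.
Variable R : realType.
Local Notation arc := (@arc_length R).

Lemma cos_gt_arc (x t : R) : 0 < x <= pi *+ 2 -> 0 < t < x ->
  cos (x / 2) < cos (t - x / 2).
Proof.
rewrite mulr2n => /andP[x0 xp] /andP[t0 tx].
rewrite -[X in _ < X]cos_norm.
have ? : 0 <= `|t - x / 2| < x / 2.
  by rewrite normr_ge0 /= ltr_norml; lra.
by rewrite ltr_cos ?in_itv /=; lra.
Qed.

Lemma cos_lt_arc (x t : R) : 0 < x -> x < t < pi *+ 2 ->
  cos (t - x / 2) < cos (x / 2).
Proof.
rewrite mulr2n => x0 /andP[xt tp].
have [tpi|tpi] := leP (t - x / 2) pi.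
  by rewrite ltr_cos ?in_itv /=; lra.
rewrite -[ltLHS]cosN -[ltLHS]cosD2pi (_ : pi *+ 2 = pi + pi); last by rewrite mulr2n.
by rewrite ltr_cos ?in_itv /=; lra.
Qed.

(** In [[0, 1]], and below 1/2 exactly when [t] is in the arc from 0 to [x]
    (centred at [x / 2]). *)
Definition arc_step (x t : R) := 2^-1 + (cos (x / 2) - cos (t - x / 2)) / 4.

Lemma arc_step_itv x t : 0 <= arc_step x t <= 1.
Proof.
rewrite /arc_step; have := cos_geN1 (x / 2); have := cos_le1 (x / 2).
by have := cos_geN1 (t - x / 2); have := cos_le1 (t - x / 2); lra.
Qed.

Lemma measurable_sharpen n x : measurable_fun (setT : set (measurableTypeR R))
  (fun t : R => sharpen n (arc_step x t)).
Proof.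
rewrite /sharpen /arc_step.
apply: measurable_funX; apply: measurable_funB => //; apply: measurable_funX.
apply: measurable_funD => //; apply: measurable_funM => //.
apply: measurable_funB => //.
apply: measurableT_comp; last exact: measurable_funB.
by apply: continuous_measurable_fun; exact: continuous_cos.
Qed.

(** Dominated convergence: [sharpen n \o arc_step x] lies between 0 and 1 and
    tends to the indicator of the arc from 0 to [x], except at its endpoints. *)
Lemma integral_arc_eq0 (u : R -> R) : arc.-integrable setT (EFin \o u) ->
  (forall x n, \int[arc]_t (u t * sharpen n (arc_step x t)) = 0) ->
  forall x, 0 < x <= pi *+ 2 -> (\int[arc]_(t in `]-oo, x[) (u t)%:E = 0)%E.
Proof.
move=> ui u0 x x2pi; have mu_ := measurable_int _ ui.
have mup : measurable_fun (setT : set (measurableTypeR R)) u by exact/measurable_EFinP.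
have bnd n t : `|u t * sharpen n (arc_step x t)| <= `|u t|.
  rewrite normrM ler_piMr// ger0_norm.
    by have /andP[] := sharpen_itv n (arc_step_itv x t).
  by have /andP[] := sharpen_itv n (arc_step_itv x t).
have mus n : measurable_fun (setT : set (measurableTypeR R))
    (fun t => (u t * sharpen n (arc_step x t))%:E).
  apply/measurable_EFinP; apply: measurable_funM => //.
  exact: measurable_sharpen.
have [] := @dominated_convergence _ _ _ arc setT measurableT
  (fun n t => (u t * sharpen n (arc_step x t))%:E)
  ((EFin \o u) \_ `]-oo, x[) (fun t => `|u t|%:E) mus.
- by apply/(measurable_restrictT _ _).1 => //; exact: measurable_funS mu_.
(* The endpoints of the arc, where arc_step is 1/2. *)
- pose N : set (measurableTypeR R) := [set 0; x; pi *+ 2].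
  have mN : measurable N by do ?apply: measurableU.
  exists (N `|` ~` `[0, (pi *+ 2)]); split.
  + by apply: measurableU => //; exact: measurableC.
  + apply/eqP; rewrite -measure_le0.
    apply: (le_trans (measureU2 _ _ _)) => //; first exact: measurableC.
    rewrite [X in (_ + X)%E](_ : _ = 0%E); last first.
      by rewrite /= /mrestr setICl measure0.
    rewrite adde0 /= /mrestr.
    apply: (@le_trans _ _ (lebesgue_measure N)).
      by apply: le_measure; rewrite ?inE//; exact: measurableI.
    rewrite countable_lebesgue_measure0//.
    by apply: finite_set_countable; rewrite /N !finite_setU.
  + move=> t; apply: contra_notP => /not_orP[/not_orP[/not_orP[t0 tx] tp]].
    move=> /contrapT; rewrite /= in_itv /= => /andP[t0' tp'] _.
    have {}t0 : 0 < t by rewrite lt0r t0' andbT; apply/eqP.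
    have {}tp : t < pi *+ 2 by rewrite lt_neqAle tp' andbT; apply/eqP.
    have t01 := arc_step_itv x t; have [x0 _] := andP x2pi.
    rewrite patchE mem_setE in_itv /=; have [tltx|xlet] := ltP t x.
      apply: cvg_EFin; first exact: nearW.
      rewrite -[X in _ --> X]mulr1; apply: cvgM; first exact: cvg_cst.
      apply: cvg_sharpen1; have /andP[-> _] := t01.
      have := @cos_gt_arc x t x2pi; rewrite t0 tltx /arc_step => /(_ isT) ?.
      by rewrite /=; lra.
    have {}xlet : x < t by rewrite lt_neqAle xlet andbT eq_sym; apply/eqP.
    apply: cvg_EFin; first exact: nearW.
    rewrite /= -[X in _ --> X](mulr0 (u t)); apply: cvgM; first exact: cvg_cst.
    apply: cvg_sharpen0; have /andP[_ ->] := t01.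
    have := @cos_lt_arc x t x0; rewrite tp xlet /arc_step andbT => /(_ isT) ?.
    by lra.
- by have := integrable_abse ui.
- by apply: aeW => t n _; rewrite lee_fin.
move=> _ _; rewrite -integral_mkcond => cv; apply/esym.
have := cvg_lim _ cv; rewrite (_ : (fun n => _) = cst 0%E); last first.
  apply/funext => n; have := u0 x n; rewrite /Rintegral => fine0.
  rewrite -[LHS]fineK ?fine0//.
  apply: integrable_fin_num => //; apply: le_integrable (ui) => // t _.
  by rewrite /= lee_fin.
by rewrite lim_cst// => ->.
Qed.

Lemma integral_arc_halfline_eq0 (u : R -> R) : arc.-integrable setT (EFin \o u) ->
  \int[arc]_t u t = 0 ->
  (forall x n, \int[arc]_t (u t * sharpen n (arc_step x t)) = 0) ->
  {ae arc, forall t, u t = 0}.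
Proof.
move=> ui u0 us; have uT : (\int[arc]_t (u t)%:E = 0)%E.
  by rewrite -[LHS]fineK ?integrable_fin_num//; congr EFin.
apply: integral_halfline_eq0 => // x.
have mh : measurable (`]-oo, x[ : set (measurableTypeR R)) by [].
have uis (A : set (measurableTypeR R)) : measurable A ->
    arc.-integrable A (EFin \o u).
  by move=> mA; exact: integrableS ui.
have [x0|x0] := leP x 0.
  apply: null_set_integral => //; first exact: measurable_int (uis _ mh).
  rewrite /= /mrestr (_ : _ `&` _ = set0) ?measure0//.
  by apply/seteqP; split=> t //=; rewrite !in_itv /=; lra.
have [xp|xp] := leP x (pi *+ 2); first by apply: integral_arc_eq0; rewrite ?x0.
have mhC := measurableC mh.
have := uT; rewrite -(setUv `]-oo, x[) integral_setU//; last 2 first.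
- by rewrite setUv; exact: measurable_int ui.
- by rewrite disj_set2E setICr.
rewrite [X in (_ + X)%E]null_set_integral ?adde0//.
  exact: measurable_int (uis _ mhC).
rewrite /= /mrestr (_ : _ `&` _ = set0) ?measure0//.
by apply/seteqP; split=> t //=; rewrite !in_itv /=; lra.
Qed.

(** [arc_step x] as a Laurent polynomial in z = cis t. *)
Definition arc_poly (x : R) (z : R[i]) : R[i] :=
  (2^-1 + cos (x / 2) / 4)%:C%C +
  ((- 8^-1)%:C%C * (cis (x / 2))^* * z + (- 8^-1)%:C%C * cis (x / 2) * z^-1).

Lemma arc_poly_cis (x t : R) :
  arc_poly x (cis t) = (arc_step x t)%:C%C.
Proof.
rewrite /arc_poly /arc_step cisV /cis cosB cosN sinN; apply/eqP; rewrite eq_complex /=.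
by apply/andP; split; apply/eqP; field.
Qed.

Lemma cis_neq0 t : cis t != 0 :> R[i].
Proof.
apply/eqP => c0; have := normsq_cis_zpow t 1; rewrite expr1z c0 /normsq /=.
by rewrite expr0n addr0 => /eqP; rewrite eq_sym oner_eq0.
Qed.

Lemma circle_int_eq0 (h : R[i] -> R[i]^o) : circle_int h = 0 ->
  \int[arc]_t complex.Re (h (cis t)) = 0 /\
  \int[arc]_t complex.Im (h (cis t)) = 0.
Proof.
move=> /eqP; rewrite mulf_eq0 => /orP[|/eqP]; last by case.
rewrite -[0]/(0%:C%C) (inj_eq (@complexI _)) invr_eq0 mulrn_eq0 /=.
by rewrite gt_eqF ?pi_gt0.
Qed.

Section Annihilator.
Variable f : R[i] -> R[i]^o.
Hypothesis fL : f \in circle_Lfun 1.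

Definition orthogonal_to (g : R[i] -> R[i]^o) : Prop :=
  g \in Linfty R /\ forall n : int, circle_int (fun z => f z * g z * z ^ n) = 0.

(** Being a multiplier, unlike being [orthogonal_to] itself, is preserved by
    products; z and its inverse are multipliers, hence so are all Laurent
    polynomials. *)
Definition multiplier (h : R[i] -> R[i]^o) : Prop :=
  h \in Linfty R /\
  forall g, orthogonal_to g -> orthogonal_to (fun z => h z * g z).

Lemma orthogonal_L1 g n : g \in Linfty R ->
  (fun z => f z * g z * z ^ n) \in circle_Lfun 1.
Proof.
move=> gL.
rewrite (_ : (fun z => _) = fun z => (z ^ n * g z) * f z); last first.
  by apply/funext => z; rewrite -mulrA mulrC (mulrC (g z)).
apply: circle_Lfun_mul_Loo; [exact: lexx| |exact: fL].
by apply: Linfty_mul => //; exact: Linfty_zpow.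
Qed.

Lemma multiplier_cst a : multiplier (fun=> a).
Proof.
split=> [|g [gL g0]]; first exact: Linfty_cst.
split=> [|n]; first by apply: Linfty_mul => //; exact: Linfty_cst.
rewrite (_ : (fun z => _) = fun z => a * (f z * g z * z ^ n)); last first.
  by apply/funext => z; ring.
by rewrite circle_intZ ?g0 ?mulr0//; exact: orthogonal_L1.
Qed.

Lemma multiplierD h k : multiplier h -> multiplier k ->
  multiplier (fun z => h z + k z).
Proof.
move=> [hL hm] [kL km]; split=> [|g go]; first exact: (circle_LfunD (leey _)).
have [hgL hg] := hm g go; have [kgL kg] := km g go.
split=> [|n].
  rewrite (_ : (fun z => _) = fun z => h z * g z + k z * g z).
    exact: (circle_LfunD (leey _)).
  by apply/funext => z; rewrite mulrDl.
rewrite (_ : (fun z => _) =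
    fun z => f z * (h z * g z) * z ^ n + f z * (k z * g z) * z ^ n); last first.
  by apply/funext => z; ring.
by rewrite circle_intD ?hg ?kg ?addr0//; exact: orthogonal_L1.
Qed.

Lemma multiplierM h k : multiplier h -> multiplier k ->
  multiplier (fun z => h z * k z).
Proof.
move=> [hL hm] [kL km]; split=> [|g go]; first exact: Linfty_mul.
rewrite (_ : (fun z => _) = fun z => h z * (k z * g z)); last first.
  by apply/funext => z; rewrite mulrA.
by apply: hm; exact: km.
Qed.

Lemma multiplierX h m : multiplier h -> multiplier (fun z => h z ^+ m).
Proof.
move=> hm; elim: m => [|m IH]; first exact: multiplier_cst.
rewrite (_ : (fun z => _) = fun z => h z * h z ^+ m); first exact: multiplierM.
by apply/funext => z; rewrite exprS.
Qed.

Lemma multiplier_zpow m : multiplier (fun z => z ^ m).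
Proof.
split=> [|g [gL g0]]; first exact: Linfty_zpow.
split=> [|n]; first by apply: Linfty_mul => //; exact: Linfty_zpow.
rewrite -[RHS](g0 (m + n)); apply: eq_circle_int => t.
by rewrite expfzDr ?cis_neq0//; move: (cis t ^ m) (cis t ^ n) => a b; ring.
Qed.

Lemma multiplier_arc_poly x : multiplier (arc_poly x).
Proof.
apply: multiplierD; first exact: multiplier_cst.
apply: multiplierD; apply: multiplierM; try exact: multiplier_cst.
  exact: (multiplier_zpow 1).
exact: (multiplier_zpow (-1)).
Qed.

Lemma multiplier_sharpen x n :
  multiplier (fun z => (1 - arc_poly x z ^+ n) ^+ (2 ^ n)).
Proof.
apply: multiplierX.
rewrite (_ : (fun z => _) = fun z => 1 + (-1) * arc_poly x z ^+ n); last first.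
  by apply/funext => z; rewrite mulN1r.
apply: multiplierD; first exact: multiplier_cst.
apply: multiplierM; first exact: multiplier_cst.
exact/multiplierX/multiplier_arc_poly.
Qed.

Hypothesis f0 : forall n : int, circle_int (fun z => f z * z ^ n) = 0.

Lemma circle_int_sharpen x n :
  circle_int (fun z => f z * (1 - arc_poly x z ^+ n) ^+ (2 ^ n)) = 0.
Proof.
have o1 : orthogonal_to (fun=> 1).
  split=> [|m]; first exact: Linfty_cst.
  by rewrite -[RHS](f0 m); apply: eq_circle_int => t; rewrite mulr1.
have [_ /(_ _ o1)[_ /(_ 0)]] := multiplier_sharpen x n.
by move=> fE; rewrite -[RHS]fE; apply: eq_circle_int => t; rewrite expr0z !mulr1.
Qed.

Lemma mul_sharpen_cis x n t :
  f (cis t) * (1 - arc_poly x (cis t) ^+ n) ^+ (2 ^ n) =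
  Complex (complex.Re (f (cis t)) * sharpen n (arc_step x t))
          (complex.Im (f (cis t)) * sharpen n (arc_step x t)).
Proof.
rewrite arc_poly_cis -rmorphXn -[1 in LHS]/(1%:C%C).
rewrite -rmorphB -rmorphXn /= -/(sharpen n _); case: (f _) => a b.
by apply/eqP; rewrite eq_complex /= !mulr0 subr0 add0r !eqxx.
Qed.

(** The real and imaginary parts of [f] are orthogonal to the trigonometric
    polynomials [sharpen n \o arc_step x], hence integrate to 0 over arcs. *)
Theorem fourier_uniqueness : ae_circle (fun z => f z = 0).
Proof.
have /andP[/Lfun1_integrable fr /Lfun1_integrable fi] := fL.
have [r0 i0] : \int[arc]_t complex.Re (f (cis t)) = 0 /\
    \int[arc]_t complex.Im (f (cis t)) = 0.
  apply: (@circle_int_eq0 f); rewrite -[RHS](f0 0); apply: eq_circle_int => t.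
  by rewrite expr0z mulr1.
have sharp x n := circle_int_eq0 (circle_int_sharpen x n).
have re0 := @integral_arc_halfline_eq0 (fun t => complex.Re (f (cis t))) fr r0 _.
have im0 := @integral_arc_halfline_eq0 (fun t => complex.Im (f (cis t))) fi i0 _.
apply: (@filterS2 _ _ (ae_filter_ringOfSetsType arc) _ _ _ _ (re0 _) (im0 _)).
- by move=> t; case: (f _) => a b /= -> ->.
- move=> x n; have [<- _] := sharp x n.
  by apply: eq_Rintegral => t _; rewrite mul_sharpen_cis.
- move=> x n; have [_ <-] := sharp x n.
  by apply: eq_Rintegral => t _; rewrite mul_sharpen_cis.
Qed.

End Annihilator.
End FourierUniqueness.

(** * The Hilbert space of the circle *)

Section L2space.
Variable R : realType.
Local Notation arc := (@arc_length R).
Local Notation L2 := (L2 R).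
Implicit Types (u v w : L2) (f g phi : R[i] -> R[i]^o) (lambda : R[i]).

Definition L2fn u : R[i] -> R[i]^o := L2fun_val (repr u).

Lemma L2fnP u : L2fn u \in circle_Lfun 2%:E.
Proof. exact: L2fun_prop. Qed.

Lemma L2_ext u v : ae_circle (fun z => L2fn u z = L2fn v z) -> u = v.
Proof. by move=> uv; rewrite -[u]reprK -[v]reprK; apply/eqP/L2P. Qed.

Lemma toL2E f : f \in circle_Lfun 2%:E ->
  ae_circle (fun z => L2fn (toL2 f) z = f z).
Proof.
move=> fL; have /eqP/L2P := reprK (\pi_L2 (insubd (0 : L2fun R) f)).
apply: ae_circleS => z; rewrite /L2fn => ->.
by have /(congr1 (@^~ z)) := insubdK (0 : L2fun R) fL.
Qed.

Lemma L2fn_linear a u v :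
  ae_circle (fun z => L2fn (a *: u + v) z = a * L2fn u z + L2fn v z).
Proof.
have /L2P : repr (a *: u + v) == a *: repr u + repr v %[mod L2].
  by rewrite reprK raddfD /= pi_L2scale !reprK.
by apply: ae_circleS => z; rewrite /L2fn => ->.
Qed.

Lemma L2fnB u v : ae_circle (fun z => L2fn (u - v) z = L2fn u z - L2fn v z).
Proof.
have := L2fn_linear (-1) v u; rewrite scaleN1r addrC; apply: ae_circleS => z ->.
by rewrite mulN1r addrC.
Qed.

Lemma L2mulJ f g : f \in circle_Lfun 2%:E -> g \in circle_Lfun 2%:E ->
  (fun z => f z * (g z)^*) \in circle_Lfun 1.
Proof. by move=> fL gL; apply: circle_Lfun_mul => //; exact: circle_Lfun_conj. Qed.

Lemma L2dot_ae u v f g : f \in circle_Lfun 2%:E -> g \in circle_Lfun 2%:E ->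
  ae_circle (fun z => L2fn u z = f z) -> ae_circle (fun z => L2fn v z = g z) ->
  L2dot u v = circle_int (fun z => f z * (g z)^*).
Proof.
move=> fL gL uf vg; apply: circle_int_ae.
- by apply: L2mulJ; exact: L2fnP.
- exact: L2mulJ.
- by apply: ae_circleS2 uf vg => z; rewrite /L2fn => -> ->.
Qed.

Lemma integral_normsq u f : f \in circle_Lfun 2%:E ->
  ae_circle (fun z => L2fn u z = f z) ->
  (\int[arc]_t (normsq (f (cis t)))%:E)%E = (pi *+ 2 * sqnorm (@L2dot R) u)%:E.
Proof.
move=> fL uf; have /andP[/Lfun1_integrable fi _] := L2mulJ fL fL.
have nE t : complex.Re (f (cis t) * (f (cis t))^*) = normsq (f (cis t)).
  by rewrite mul_conjC.
rewrite /sqnorm (L2dot_ae fL fL uf uf) /circle_int /= mul0r subr0.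
rewrite mulVKf; last by rewrite gt_eqF // pmulrn_lgt0 ?pi_gt0.
rewrite /Rintegral fineK; last exact: integrable_fin_num.
by apply: eq_integral => t _; rewrite /= nE.
Qed.

Lemma inner_product_L2 : inner_product (@L2dot R).
Proof.
split.
- move=> a u v w.
  have uvL : (fun z => a * L2fn u z + L2fn v z) \in circle_Lfun 2%:E.
    by apply: circle_LfunD; rewrite ?lee1n ?circle_LfunZ ?lee1n ?L2fnP.
  rewrite (L2dot_ae uvL (L2fnP w) (L2fn_linear a u v) (aeW _ _))//.
  rewrite -circle_int_linear ?L2mulJ ?L2fnP//; apply: eq_circle_int => t.
  by rewrite mulrDl -mulrA.
- move=> u v; rewrite -circle_int_conj; last by rewrite L2mulJ ?L2fnP.
  by apply: eq_circle_int => t; rewrite rmorphM /= conjCK mulrC.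
- by move=> u; apply: circle_int_ge0 => t; rewrite mul_conjC_ge0.
- move=> u u0.
  have := integral_normsq (L2fnP u) (aeW _ (fun=> erefl)).
  rewrite /sqnorm u0 /= mulr0 => int0.
  have := int0; under eq_integral.
    move=> t _; rewrite -(gee0_abs (x := (normsq _)%:E)); last first.
      by rewrite lee_fin normsq_ge0.
    over.
  have /andP[/Lfun_measurable mr /Lfun_measurable mi] := L2fnP u.
  move/ae_eq_integral_abs => /(_ measurableT) H.
  apply: L2_ext; have zL := @toL2E (fun=> 0).
  have /H : measurable_fun (setT : set (measurableTypeR R))
      (fun t => (normsq (L2fn u (cis t)))%:E).
    by apply/measurable_EFinP; apply: measurable_funD; exact: measurable_funX.
  have := L2fnB u u; rewrite subrr => z0 n0.
  apply: (@filterS2 _ _ (ae_filter_ringOfSetsType arc)) z0 n0 => t z0 /(_ I).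
  by case=> /normsq_eq0 ->; rewrite z0 subrr.
Qed.

Lemma sqr_le_normsqL (z : R[i]) : complex.Re z ^+ 2 <= normsq z.
Proof. by rewrite lerDl sqr_ge0. Qed.

Lemma sqr_le_normsqR (z : R[i]) : complex.Im z ^+ 2 <= normsq z.
Proof. by rewrite lerDr sqr_ge0. Qed.

(** [riesz_fischer] applies to the real and imaginary parts; its limits are
    again functions of z = cis t. *)
Lemma complete_L2 : complete_ip (@L2dot R).
Proof.
move=> u ucau; have p0 := twopi_ge0 R.
pose a n := L2fn (u n).
have mre n : measurable_fun (setT : set (measurableTypeR R))
    (fun t => complex.Re (a n (cis t))).
  by have /andP[/Lfun_measurable ? _] := L2fnP (u n).
have mim n : measurable_fun (setT : set (measurableTypeR R))
    (fun t => complex.Im (a n (cis t))).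
  by have /andP[_ /Lfun_measurable ?] := L2fnP (u n).
have aL n m : (fun z => a m z - a n z) \in circle_Lfun 2%:E.
  by apply: circle_LfunB; rewrite ?lee1n// L2fnP.
have nsq n m : (n <= m)%N ->
    (\int[arc]_t (normsq (a m (cis t) - a n (cis t)))%:E
      <= (pi *+ 2 * 4^-1 ^+ n)%:E)%E.
  move=> nm; rewrite (integral_normsq (aL n m) (L2fnB _ _)) lee_fin.
  by rewrite ler_wpM2l// ucau.
have mnsq n m : measurable_fun (setT : set (measurableTypeR R))
    (fun t => (normsq (a m (cis t) - a n (cis t)))%:E).
  have /andP[/Lfun_measurable mr /Lfun_measurable mi] := aL n m.
  by apply/measurable_EFinP; apply: measurable_funD; exact: measurable_funX.
have [|mfr fr] := @riesz_fischer _ _ R arc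
    (fun n t => complex.Re (a n (cis t))) (pi *+ 2) (arc_length_fin R) mre _.
  move=> n m nm; apply: le_trans (nsq _ _ nm); apply: ge0_le_integral => //.
  - by move=> t _; rewrite lee_fin sqr_ge0.
  - apply/measurable_EFinP; apply: measurable_funX; exact: measurable_funB.
  - move=> t _; rewrite lee_fin; apply: le_trans (sqr_le_normsqL _).
    by case: (a m _) (a n _) => ? ? [].
have [|mfi fi] := @riesz_fischer _ _ R arc
    (fun n t => complex.Im (a n (cis t))) (pi *+ 2) (arc_length_fin R) mim _.
  move=> n m nm; apply: le_trans (nsq _ _ nm); apply: ge0_le_integral => //.
  - by move=> t _; rewrite lee_fin sqr_ge0.
  - apply/measurable_EFinP; apply: measurable_funX; exact: measurable_funB.
  - move=> t _; rewrite lee_fin; apply: le_trans (sqr_le_normsqR _).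
    by case: (a m _) (a n _) => ? ? [].
pose b z : R[i] := Complex (fine (limn_esup (fun n => (complex.Re (a n z))%:E)))
                    (fine (limn_esup (fun n => (complex.Im (a n z))%:E))).
have L2i (h : R -> R) : measurable_fun (setT : set (measurableTypeR R)) h ->
    (\int[arc]_t ((h t) ^+ 2)%:E < +oo)%E -> h \in Lfun arc 2%:E.
  move=> mh hi; apply/LfunP_fin; first by rewrite ler1n.
  split=> //; move: hi; congr (_ < _)%E; apply: eq_integral => t _.
  by rewrite powR_mulrn// real_normK ?num_real.
have baL n : (fun z => b z - a n z) \in circle_Lfun 2%:E.
  apply/andP; split.
    rewrite (_ : (fun t => _) =
        fun t => complex.Re (b (cis t)) - complex.Re (a n (cis t))).
      apply: L2i; first exact: measurable_funB.
      by apply: le_lt_trans (fr n) _; exact: ltry.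
    by apply/funext => t; case: (b _) (a n _) => ? ? [].
  rewrite (_ : (fun t => _) =
      fun t => complex.Im (b (cis t)) - complex.Im (a n (cis t))).
    apply: L2i; first exact: measurable_funB.
    by apply: le_lt_trans (fi n) _; exact: ltry.
  by apply/funext => t; case: (b _) (a n _) => ? ? [].
have bL : b \in circle_Lfun 2%:E.
  rewrite (_ : b = fun z => (b z - a 0%N z) + a 0%N z).
    by apply: circle_LfunD; rewrite ?lee1n// L2fnP.
  by apply/funext => z; rewrite subrK.
exists (toL2 b), 2 => // n.
have bn : ae_circle (fun z => L2fn (toL2 b - u n) z = b z - a n z).
  by apply: ae_circleS2 (L2fnB (toL2 b) (u n)) (toL2E bL) => z -> ->.
have pgt0 : 0 < pi *+ 2 :> R by rewrite pmulrn_lgt0 ?pi_gt0.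
rewrite -(ler_pM2l pgt0) -lee_fin -(integral_normsq (baL n) bn).
under eq_integral => t _ do rewrite /normsq EFinD.
rewrite ge0_integralD//; first last.
- apply/measurable_EFinP; apply: measurable_funX.
  by have /andP[_ /Lfun_measurable] := baL n.
- by move=> t _; rewrite lee_fin sqr_ge0.
- apply/measurable_EFinP; apply: measurable_funX.
  by have /andP[/Lfun_measurable] := baL n.
- by move=> t _; rewrite lee_fin sqr_ge0.
rewrite mulrCA mulrA mulr_natl mulr2n mulrDl EFinD; apply: leeD.
  apply: le_trans (fr n); rewrite le_eqVlt; apply/orP; left; apply/eqP.
  by apply: eq_integral => t _; case: (a n _).
apply: le_trans (fi n); rewrite le_eqVlt; apply/orP; left; apply/eqP.
by apply: eq_integral => t _; case: (a n _).
Qed.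

End L2space.

(** * The Hardy space and Toeplitz forms *)

Section Hardy.
Variable R : realType.
Local Notation L2 := (L2 R).
Local Notation H2 := (H2 R).
Implicit Types (u v w : L2) (h k : H2) (f g phi psi : R[i] -> R[i]^o) (lambda : R[i]).

Definition zpow (n : int) : L2 := toL2 (fun z => z ^ n).

Lemma zpowE n : ae_circle (fun z => L2fn (zpow n) z = z ^ n).
Proof. exact: toL2E (circle_Lfun_zpow R n). Qed.

Lemma fourier_dot u n : fourier u n = L2dot u (zpow n).
Proof.
apply/esym/L2dot_ae; [exact: L2fnP|exact: circle_Lfun_zpow|exact: aeW|exact: zpowE].
Qed.

(** H^2 is the orthogonal complement of the negative powers of z. *)
Lemma closed_hardy : closed_ip (@L2dot R) (@hardy R).
Proof.
move=> u x C C0 uW ux; apply/asboolP => n n0; rewrite fourier_dot.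
apply: (orthogonal_closed (inner_product_L2 R) C0 _ ux) => m.
by have /asboolP/(_ n n0) := uW m; rewrite fourier_dot.
Qed.

Lemma inner_product_H2 : inner_product (@H2dot R).
Proof.
have ip := inner_product_L2 R.
split=> [a x y z|x y|x|x x0]; rewrite ?/H2dot.
- exact: (dotPl ip).
- exact: (dotC ip).
- exact: (dot_ge0 ip).
- by apply: val_inj; exact: (dot_eq0 ip).
Qed.

(** The projection acts componentwise, and in a form whose second argument
    comes from H^2 it disappears. *)
Lemma H2C2_projectionP (x : L2 * L2) (k : H2 * H2) :
  sum_dot (@H2dot R) (proj_H2C2 x) k = sum_dot (@L2dot R) x (H2C2_incl k).
Proof.
have ip := inner_product_L2 R.
have [y1 W1 o1] := projection_exists ip x.1 (@complete_L2 R) closed_hardy.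
have [y2 W2 o2] := projection_exists ip x.2 (@complete_L2 R) closed_hardy.
have : exists y : H2 * H2, forall w : H2 * H2,
    sum_dot (@L2dot R) (x - H2C2_incl y) (H2C2_incl w) = 0.
  exists (MkH2 W1, MkH2 W2) => w; rewrite /sum_dot /=.
  by rewrite o1 ?o2 ?addr0 ?H2prop.
move/(@xgetPex _ 0 [set y | forall w : H2 * H2,
    sum_dot (@L2dot R) (x - H2C2_incl y) (H2C2_incl w) = 0]) => /(_ k) /eqP.
by rewrite (dotBl (inner_product_sum ip)) subr_eq0 => /eqP ->.
Qed.

(** Between elements of H^2 this is the form of the Toeplitz operator with
    symbol [phi]. *)
Definition mul_form phi u v : R[i] :=
  circle_int (fun z => phi z * L2fn u z * (L2fn v z)^*).

Lemma mulL2E phi u : phi \in Linfty R ->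
  ae_circle (fun z => L2fn (mulL2 phi u) z = phi z * L2fn u z).
Proof.
move=> pL; apply: toL2E; apply: circle_Lfun_mul_Loo => //; first by rewrite ler1n.
exact: L2fnP.
Qed.

Lemma mulL2_Lfun phi u : phi \in Linfty R ->
  (fun z => phi z * L2fn u z) \in circle_Lfun 2%:E.
Proof.
by move=> pL; apply: circle_Lfun_mul_Loo; rewrite ?ler1n// L2fnP.
Qed.

Lemma mulL2_dot phi u v : phi \in Linfty R ->
  L2dot (mulL2 phi u) v = mul_form phi u v.
Proof.
move=> pL; apply: L2dot_ae (mulL2E u pL) (aeW _ _) => //; last exact: L2fnP.
exact: mulL2_Lfun.
Qed.

Lemma mul_form_L1 phi u v : phi \in Linfty R ->
  (fun z => phi z * L2fn u z * (L2fn v z)^*) \in circle_Lfun 1.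
Proof. by move=> pL; apply: L2mulJ; [exact: mulL2_Lfun|exact: L2fnP]. Qed.

Lemma mul_formPl phi a u v w : phi \in Linfty R ->
  mul_form phi (a *: u + v) w = a * mul_form phi u w + mul_form phi v w.
Proof.
move=> pL; rewrite -circle_int_linear ?mul_form_L1//; apply: circle_int_ae.
- exact: mul_form_L1.
- have [_ cl] := @circle_Lfun_submod_closed R 1 (lexx _).
  by apply: cl; exact: mul_form_L1.
- apply: ae_circleS (L2fn_linear a u v) => z ->; rewrite !fctE.
  rewrite -[_ *: _]/(a * (phi z * L2fn u z * (L2fn w z)^*)); ring.
Qed.

Lemma mul_formDl phi u v w : phi \in Linfty R ->
  mul_form phi (u + v) w = mul_form phi u w + mul_form phi v w.
Proof. by move=> pL; rewrite -[u in LHS]scale1r mul_formPl// mul1r. Qed.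

Lemma mul_form0l phi w : phi \in Linfty R -> mul_form phi 0 w = 0.
Proof.
move=> pL; have /esym/eqP := mul_formDl 0 0 w pL.
by rewrite addr0 -subr_eq0 addrK => /eqP.
Qed.

Lemma mul_formZl phi a u w : phi \in Linfty R ->
  mul_form phi (a *: u) w = a * mul_form phi u w.
Proof. by move=> pL; rewrite -[a *: u]addr0 mul_formPl// mul_form0l// addr0. Qed.

Lemma mul_formNl phi u w : phi \in Linfty R ->
  mul_form phi (- u) w = - mul_form phi u w.
Proof. by move=> pL; rewrite -scaleN1r mul_formZl// mulN1r. Qed.

Lemma mul_formDr phi u v w : phi \in Linfty R ->
  mul_form phi w (u + v) = mul_form phi w u + mul_form phi w v.
Proof.
by move=> pL; rewrite -!mulL2_dot// (dotDr (inner_product_L2 R)).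
Qed.

Lemma mul_formZr phi a u w : phi \in Linfty R ->
  mul_form phi w (a *: u) = a^* * mul_form phi w u.
Proof.
by move=> pL; rewrite -!mulL2_dot// (dotZr (inner_product_L2 R)).
Qed.

Lemma mul_formNr phi u w : phi \in Linfty R ->
  mul_form phi w (- u) = - mul_form phi w u.
Proof.
by move=> pL; rewrite -!mulL2_dot// (dotNr (inner_product_L2 R)).
Qed.

Lemma mul_form0r phi w : phi \in Linfty R -> mul_form phi w 0 = 0.
Proof.
by move=> pL; rewrite -(subrr 0) mul_formDr// mul_formNr// subrr.
Qed.

Lemma mul_formD phi psi u v : phi \in Linfty R -> psi \in Linfty R ->
  mul_form (fun z => phi z + psi z) u v = mul_form phi u v + mul_form psi u v.
Proof.
move=> pL qL; rewrite -circle_intD ?mul_form_L1//; apply: eq_circle_int => t.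
by rewrite !mulrDl.
Qed.

Lemma mul_formB phi psi u v : phi \in Linfty R -> psi \in Linfty R ->
  mul_form (fun z => phi z - psi z) u v = mul_form phi u v - mul_form psi u v.
Proof.
move=> pL qL; rewrite -circle_intB ?mul_form_L1//; apply: eq_circle_int => t.
by rewrite !mulrBl.
Qed.

Lemma mul_formZ phi a u v : phi \in Linfty R ->
  mul_form (fun z => a * phi z) u v = a * mul_form phi u v.
Proof.
move=> pL; rewrite -circle_intZ ?mul_form_L1//; apply: eq_circle_int => t.
by rewrite !mulrA.
Qed.

Lemma mul_form_ae phi psi u v : phi \in Linfty R -> psi \in Linfty R ->
  ae_circle (fun z => phi z = psi z) -> mul_form phi u v = mul_form psi u v.
Proof.
move=> pL qL pq; apply: circle_int_ae; rewrite ?mul_form_L1//.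
by apply: ae_circleS pq => z ->.
Qed.

Lemma sqnorm_mulL2 phi M u : phi \in Linfty R -> 0 <= M ->
  ae_circle (fun z => normsq (phi z) <= M) ->
  sqnorm (@L2dot R) (mulL2 phi u) <= M * sqnorm (@L2dot R) u.
Proof.
move=> pL M0 pM; have pgt0 : 0 < pi *+ 2 :> R by rewrite pmulrn_lgt0 ?pi_gt0.
have puL := mulL2_Lfun u pL.
rewrite -(ler_pM2l pgt0) [leRHS]mulrCA -lee_fin [leRHS]EFinM.
rewrite -(integral_normsq puL (mulL2E u pL)).
rewrite -(integral_normsq (L2fnP u) (aeW _ (fun=> erefl))).
have mn f : f \in circle_Lfun 2%:E -> measurable_fun (setT : set (measurableTypeR R))
    (fun t => (normsq (f (cis t)))%:E).
  move=> /andP[/Lfun_measurable mr /Lfun_measurable mi].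
  by apply/measurable_EFinP; apply: measurable_funD; exact: measurable_funX.
rewrite -ge0_integralZl_EFin//; first last.
- exact: mn (L2fnP u).
- by move=> t _; rewrite lee_fin normsq_ge0.
apply: ae_ge0_le_integral => //.
- by move=> t _; rewrite lee_fin normsq_ge0.
- exact: mn puL.
- by move=> t _; rewrite -EFinM lee_fin mulr_ge0 ?normsq_ge0.
- by apply: measurable_funeM; exact: mn (L2fnP u).
- apply: (@filterS _ _ (ae_filter_ringOfSetsType (@arc_length R))) pM => t pM _.
  by rewrite -EFinM lee_fin normsqM ler_wpM2r ?normsq_ge0.
Qed.

Lemma conj_cis_zpow t n : (cis t ^ n)^* = cis t ^ (- n) :> R[i].
Proof.
have c : (cis t)^* = (cis t)^-1 :> R[i].
  by rewrite cisV /cis cosN sinN.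
rewrite -exprz_inv -c; case: n => n /=.
  by rewrite -?exprnP rmorphXn.
by rewrite NegzE -?exprnN fmorphV rmorphXn.
Qed.

(** Reflecting the circle in its diameters turns [z^n] into unimodular
    multiples of its conjugate, among them opposite ones. *)
Lemma circle_int_zpow (n : nat) : (0 < n)%N ->
  circle_int (fun z : R[i] => z ^ n%:Z) = 0.
Proof.
move=> n0; have zL : (fun z : R[i] => z ^ n%:Z) \in @circle_Lfun R 1.
  by apply: circle_Lfun2_1; exact: circle_Lfun_zpow.
pose J : R[i] := circle_int (fun z : R[i] => z ^ n%:Z).
have refl (lambda : R[i]) : `|lambda| = 1 -> J = lambda ^+ n * J^*.
  move=> l1; rewrite /J -circle_int_conj// -circle_intZ ?circle_Lfun_conj//.
  rewrite -(circle_int_reflect l1 zL); apply: eq_circle_int => t.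
  by rewrite -!exprnP exprMn rmorphXn.
have norm_cis (t : R) : `|cis t| = 1 :> R[i].
  by rewrite normc_def /= cos2Dsin2 sqrtr1.
(* 1 and cis (pi / n) have n-th powers 1 and -1. *)
have J1 := refl 1 (normr1 _); rewrite expr1n mul1r in J1.
have := refl (cis (pi / n%:R)) (norm_cis _).
rewrite cisX -[_ *+ n]mulr_natr mulfVK ?pnatr_eq0 -?lt0n// -J1 /cis cospi sinpi.
rewrite -[Complex (-1) 0]/((-1)%:C%C) rmorphN1 mulN1r => /eqP.
by rewrite -subr_eq0 opprK -mulr2n mulrn_eq0 /= => /eqP.
Qed.

Lemma zpow_hardy (n : nat) : zpow n%:Z \in @hardy R.
Proof.
apply/asboolP => -[m|m] // _; rewrite fourier_dot.
rewrite (L2dot_ae (circle_Lfun_zpow R n) (circle_Lfun_zpow R (Negz m))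
  (zpowE _) (zpowE _)).
rewrite -[RHS](@circle_int_zpow (n + m.+1)); last by rewrite addnS.
apply: eq_circle_int => t.
by rewrite conj_cis_zpow NegzE opprK PoszD expfzDr ?cis_neq0.
Qed.

Definition H2zpow (n : nat) : H2 := MkH2 (zpow_hardy n).

Lemma mul_form_zpow phi (j l : nat) : phi \in Linfty R ->
  mul_form phi (zpow j) (zpow l) = circle_int (fun z => phi z * z ^ (j%:Z - l%:Z)).
Proof.
move=> pL; transitivity (circle_int (fun z => phi z * (z ^ j%:Z * (z ^ l%:Z)^*))).
  apply: circle_int_ae; first exact: mul_form_L1.
    apply: circle_Lfun_mul_Loo => //; apply: L2mulJ; exact: circle_Lfun_zpow.
  by apply: ae_circleS2 (zpowE j) (zpowE l) => z -> ->; rewrite mulrA.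
by apply: eq_circle_int => t; rewrite conj_cis_zpow -expfzDr ?cis_neq0.
Qed.

(** On monomials the form of [phi - psi] yields its Fourier coefficients, of
    all indices since j - l ranges over all integers. *)
Lemma mul_form_uniqueness phi psi : phi \in Linfty R -> psi \in Linfty R ->
  (forall h k,
    mul_form phi (H2val h) (H2val k) = mul_form psi (H2val h) (H2val k)) ->
  ae_circle (fun z => phi z = psi z).
Proof.
move=> pL qL pq; have dL : (fun z => phi z - psi z) \in Linfty R.
  exact: circle_LfunB (leey _) pL qL.
have d1 : (fun z => phi z - psi z) \in @circle_Lfun R 1.
  by apply: circle_Lfun2_1; apply: Linfty_subset dL; rewrite ler1n.
have := @fourier_uniqueness R (fun z => phi z - psi z) d1 _.
have jl (j l : nat) : circle_int (fun z => (phi z - psi z) * z ^ (j%:Z - l%:Z)) = 0.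
  rewrite -mul_form_zpow// mul_formB//.
  by rewrite (pq (H2zpow j) (H2zpow l)) subrr.
move=> /(_ _)/ae_circleS; apply=> [z /eqP|n]; first by rewrite subr_eq0 => /eqP.
case: n => n; first by have := jl n 0%N; rewrite subr0.
by have := jl 0%N n.+1; rewrite sub0r -NegzE.
Qed.

Section Reflection.
Variable lambda : R[i].
Hypothesis lambda1 : `|lambda| = 1.

Definition conj_reflect u : L2 :=
  toL2 (fun z => (L2fn u (lambda * z^*))^*).

Lemma conj_reflect_Lfun u :
  (fun z => (L2fn u (lambda * z^*))^*) \in circle_Lfun 2%:E.
Proof.
apply: circle_Lfun_conj; apply: circle_Lfun_reflect => //; first by rewrite ler1n.
exact: L2fnP.
Qed.

Lemma conj_reflectE u :
  ae_circle (fun z => L2fn (conj_reflect u) z = (L2fn u (lambda * z^*))^*).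
Proof. exact: toL2E (conj_reflect_Lfun u). Qed.

(** Under the reflection the conjugations fall on the opposite arguments, which
    is why [u] and [v] change places. *)
Lemma mul_form_reflect phi u v : phi \in Linfty R ->
  mul_form phi (conj_reflect v) (conj_reflect u) =
  mul_form (fun z => phi (lambda * z^*)) u v.
Proof.
move=> pL; have prL := Linfty_reflect lambda1 pL.
rewrite -[RHS](circle_int_reflect lambda1 (mul_form_L1 u v prL)).
apply: circle_int_ae; first exact: mul_form_L1.
  exact: circle_Lfun_reflect (lexx _) (mul_form_L1 u v prL).
have reflK : ae_circle (fun z => lambda * (lambda * z^*)^* = z).
  by apply: aeW => t; exact: reflect_involutive.
have uv := ae_circleS2 (fun z => @conj _ _) (conj_reflectE u) (conj_reflectE v).
apply: ae_circleS2 reflK uv => z zK [-> ->].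
by rewrite zK conjCK mulrAC.
Qed.

End Reflection.
End Hardy.

(** * The conjugation by reflection *)

Section ConjugationC1.
Variable R : realType.
Local Notation L2 := (L2 R).
Local Notation H2 := (H2 R).
Variable lambda : R[i].
Hypothesis lambda1 : `|lambda| = 1.
Implicit Types (u v : L2).

Lemma conj_reflect_conjugation : conjugation (@L2dot R) (conj_reflect lambda).
Proof.
have reflL u := conj_reflect_Lfun lambda1 u.
split=> [a u v|u|u v].
- apply: L2_ext.
  have uv := ae_circleS2 (fun z => @conj _ _)
    (conj_reflectE lambda1 u) (conj_reflectE lambda1 v).
  have lin := ae_circleS2 (fun z => @conj _ _)
    (ae_circle_reflect lambda1 (L2fn_linear a u v))
    (L2fn_linear a^* (conj_reflect lambda u) (conj_reflect lambda v)).
  have := ae_circleS2 (fun z => @conj _ _) uv lin.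
  apply: ae_circleS2 (conj_reflectE lambda1 (a *: u + v)) => z -> [[-> ->] [-> ->]].
  by rewrite rmorphD rmorphM.
- apply: L2_ext.
  have reflK : ae_circle (fun z => lambda * (lambda * z^*)^* = z).
    by apply: aeW => t; exact: reflect_involutive.
  have := ae_circleS2 (fun z => @conj _ _) reflK
    (ae_circle_reflect lambda1 (conj_reflectE lambda1 u)).
  apply: ae_circleS2 (conj_reflectE lambda1 (conj_reflect lambda u)) => z -> [zK ->].
  by rewrite conjCK zK.
- rewrite (L2dot_ae (reflL u) (reflL v)
    (conj_reflectE lambda1 u) (conj_reflectE lambda1 v)).
  rewrite -[RHS](circle_int_reflect lambda1 (L2mulJ (L2fnP v) (L2fnP u))).
  by apply: eq_circle_int => t; rewrite conjCK mulrC.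
Qed.

Lemma conjC_zpow (z : R[i]) n : (z^*) ^ n = (z ^ n)^*.
Proof. by case: n => n; rewrite ?NegzE -?exprnN -?exprnP ?fmorphV rmorphXn. Qed.

(** The coefficient of index n is conjugated and multiplied by lambda^-n, so
    vanishing coefficients stay 0. *)
Lemma conj_reflect_hardy (u : L2) :
  u \in @hardy R -> conj_reflect lambda u \in @hardy R.
Proof.
move=> /asboolP uW; apply/asboolP => n n0; rewrite fourier_dot.
rewrite (L2dot_ae (conj_reflect_Lfun lambda1 u) (circle_Lfun_zpow R n)
  (conj_reflectE lambda1 u) (zpowE R n)).
have zL := circle_Lfun_zpow R n.
have uzL := L2mulJ (L2fnP u) zL.
transitivity (lambda ^ (- n) * (fourier u n)^*); last by rewrite uW// conjC0 mulr0.
rewrite -circle_int_conj// -circle_intZ ?circle_Lfun_conj//.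
have uzL' := circle_LfunZ (lambda ^ (- n)) (lexx 1%E) (circle_Lfun_conj uzL).
rewrite -(circle_int_reflect lambda1 uzL'); apply: eq_circle_int => t.
have l0 : lambda != 0 by rewrite -normr_eq0 lambda1 oner_eq0.
rewrite rmorphM /= conjCK mulrCA; congr (_ * _).
rewrite exprzMl ?unitfE ?conjC_eq0 ?cis_neq0//.
rewrite mulrA -expfzDr// addNr expr0z mul1r.
by rewrite conjC_zpow.
Qed.

Lemma H2val_C1 (h : H2) : H2val (C1 lambda h) = conj_reflect lambda (H2val h).
Proof.
have := insubdK (0 : H2) (conj_reflect_hardy (H2prop h)).
exact.
Qed.

Lemma C1_conjugation : conjugation (@H2dot R) (C1 lambda).
Proof.
have [anti inv iso] := conj_reflect_conjugation.
split=> [a h k|h|h k].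
- apply: val_inj; apply: (etrans (H2val_C1 _)).
  apply: (etrans (anti a (H2val h) (H2val k))); apply/esym.
  exact: (f_equal2 (fun x y => a^* *: x + y) (H2val_C1 h) (H2val_C1 k)).
- by apply: val_inj; rewrite /= !H2val_C1 inv.
- rewrite /H2dot -(iso (H2val h) (H2val k)).
  exact: (f_equal2 (@L2dot R) (H2val_C1 h) (H2val_C1 k)).
Qed.

End ConjugationC1.


(** * Block Toeplitz operators *)

Section BlockToeplitz.
Variable R : realType.
Local Notation H2 := (H2 R).
Local Notation dot2 := (sum_dot (@H2dot R)).

(** The form <T h, k> of the block Toeplitz operator, by
    [block_toeplitz_form]. *)
Definition block_form (phi1 phi2 phi3 phi4 : R[i] -> R[i])
    (h k : H2 * H2) : R[i] :=
  mul_form phi1 (H2val h.1) (H2val k.1) +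
  mul_form phi2 (H2val h.2) (H2val k.1) +
  (mul_form phi3 (H2val h.1) (H2val k.2) +
   mul_form phi4 (H2val h.2) (H2val k.2)).

Variables phi1 phi2 phi3 phi4 : R[i] -> R[i].
Hypotheses (phi1L : phi1 \in Linfty R) (phi2L : phi2 \in Linfty R).
Hypotheses (phi3L : phi3 \in Linfty R) (phi4L : phi4 \in Linfty R).
Local Notation T := (block_toeplitz (mx2 phi1 phi2 phi3 phi4)).

Lemma block_toeplitz_form h k :
  dot2 (T h) k = block_form phi1 phi2 phi3 phi4 h k.
Proof.
have ip := inner_product_L2 R.
rewrite H2C2_projectionP /sum_dot /= !mxE /= !(dotDl ip).
by rewrite !mulL2_dot.
Qed.

Lemma Linfty_bound (phi : R[i] -> R[i]) : phi \in Linfty R ->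
  exists2 M, 0 <= M & ae_circle (fun z => normsq (phi z) <= M).
Proof.
move=> /LinftyP[_ _ [M pM]]; exists (Num.max 0 M); first by rewrite le_max lexx.
by apply: ae_circleS pM => z pM; rewrite le_max pM orbT.
Qed.

(** Projections do not increase norms, and multiplication by a bounded symbol
    is bounded. *)
Lemma block_toeplitz_bounded : bounded_operator dot2 T.
Proof.
have ip := inner_product_L2 R; have ip2 := inner_product_sum ip.
have ipH := inner_product_sum (inner_product_H2 R).
split.
  have := block_toeplitz_form; move: T => T' T'E.
  move=> a h k; apply: (dot_inj ipH) => w; rewrite (dotPl ipH) !T'E.
  rewrite /block_form.
  have -> : H2val (a *: h + k).1 = a *: H2val h.1 + H2val k.1 by [].
  have -> : H2val (a *: h + k).2 = a *: H2val h.2 + H2val k.2 by [].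
  move: (H2val h.1) (H2val h.2) (H2val k.1) (H2val k.2) => h1 h2 k1 k2.
  rewrite !mul_formPl//; do 8!move: (mul_form _ _ _) => ?.
  by ring.
have [M1 M10 pM1] := Linfty_bound phi1L; have [M2 M20 pM2] := Linfty_bound phi2L.
have [M3 M30 pM3] := Linfty_bound phi3L; have [M4 M40 pM4] := Linfty_bound phi4L.
(* The factor 2 bounds the square of the norm of a sum of two vectors. *)
pose M := 2 * (M1 + M2 + M3 + M4).
have M0 : 0 <= M by rewrite mulr_ge0// !addr_ge0.
exists (Num.sqrt M) => h; rewrite -sqrtrM// ler_wsqrtr//.
rewrite -!/(sqnorm _ _).
set x := operator_mx2 (mulL2 phi1) (mulL2 phi2) (mulL2 phi3) (mulL2 phi4)
  (H2C2_incl h).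
have Tx : T h = proj_H2C2 x by rewrite /block_toeplitz !mxE.
have proj_le : sqnorm dot2 (proj_H2C2 x) <= sqnorm (sum_dot (@L2dot R)) x.
  set y := proj_H2C2 x.
  have yE : sqnorm (sum_dot (@L2dot R)) (H2C2_incl y) = sqnorm dot2 y by [].
  rewrite -yE -[x in leRHS](subrK (H2C2_incl y)) (sqnorm_pythagoras ip2).
    by rewrite lerDr (sqnorm_ge0 ip2).
  by rewrite (dotBl ip2) -(H2C2_projectionP x y) subrr.
rewrite Tx; apply: (le_trans proj_le).
rewrite !sqnorm_sum /x /operator_mx2 /=.
have s1 := sqnorm_mulL2 (H2val h.1) phi1L M10 pM1.
have s2 := sqnorm_mulL2 (H2val h.2) phi2L M20 pM2.
have s3 := sqnorm_mulL2 (H2val h.1) phi3L M30 pM3.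
have s4 := sqnorm_mulL2 (H2val h.2) phi4L M40 pM4.
have a0 := sqnorm_ge0 ip (H2val h.1); have b0 := sqnorm_ge0 ip (H2val h.2).
have -> : sqnorm (@H2dot R) h.1 = sqnorm (@L2dot R) (H2val h.1) by [].
have -> : sqnorm (@H2dot R) h.2 = sqnorm (@L2dot R) (H2val h.2) by [].
apply: (le_trans (lerD (sqnormD ip _ _) (sqnormD ip _ _))).
move: s1 s2 s3 s4 a0 b0; rewrite /M.
move: (sqnorm _ (H2val h.1)) (sqnorm _ (H2val h.2)) => a b.
do 4!move: (sqnorm _ _) => ?.
by move=> ? ? ? ? ? ?; nra.
Qed.

End BlockToeplitz.

(** Pairs with a zero component isolate the four symbols. *)
Lemma block_form_eq (R : realType) (p1 p2 p3 p4 q1 q2 q3 q4 : R[i] -> R[i]) :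
  p1 \in Linfty R -> p2 \in Linfty R -> p3 \in Linfty R -> p4 \in Linfty R ->
  q1 \in Linfty R -> q2 \in Linfty R -> q3 \in Linfty R -> q4 \in Linfty R ->
  (forall h k, block_form p1 p2 p3 p4 h k = block_form q1 q2 q3 q4 h k) <->
  [/\ ae_circle (fun z => p1 z = q1 z), ae_circle (fun z => p2 z = q2 z),
      ae_circle (fun z => p3 z = q3 z) & ae_circle (fun z => p4 z = q4 z)].
Proof.
move=> p1L p2L p3L p4L q1L q2L q3L q4L; split=> [pq|[e1 e2 e3 e4] h k].
  have H20 : H2val (0 : H2 R) = 0 by [].
  split; apply: mul_form_uniqueness => // h k.
  - have := pq (h, 0) (k, 0); rewrite /block_form /fst /snd H20.
    by rewrite !(mul_form0l, mul_form0r)// !addr0.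
  - have := pq (0, h) (k, 0); rewrite /block_form /fst /snd H20.
    by rewrite !(mul_form0l, mul_form0r)// !addr0 !add0r.
  - have := pq (h, 0) (0, k); rewrite /block_form /fst /snd H20.
    by rewrite !(mul_form0l, mul_form0r)// !addr0 !add0r.
  - have := pq (0, h) (0, k); rewrite /block_form /fst /snd H20.
    by rewrite !(mul_form0l, mul_form0r)// !add0r.
rewrite /block_form (mul_form_ae _ _ p1L q1L e1) (mul_form_ae _ _ p2L q2L e2).
by rewrite (mul_form_ae _ _ p3L q3L e3) (mul_form_ae _ _ p4L q4L e4).
Qed.

Section ConjugatedForm.
Variable R : realType.
Variable lambda : R[i].
Hypothesis lambda1 : `|lambda| = 1.
Variables phi1 phi2 phi3 phi4 : R[i] -> R[i].
Hypotheses (phi1L : phi1 \in Linfty R) (phi2L : phi2 \in Linfty R).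
Hypotheses (phi3L : phi3 \in Linfty R) (phi4L : phi4 \in Linfty R).

Let refl (phi : R[i] -> R[i]) : R[i] -> R[i] := fun z => phi (lambda * z^*).

(** [mul_form_reflect] composes the symbols with the reflection and exchanges
    the arguments; the matrix (1, 1; 1, -1) / sqrt 2 mixes the entries. *)
Lemma block_form_C1_block (h k : H2 R * H2 R) :
  block_form phi1 phi2 phi3 phi4 (C1_block lambda k) (C1_block lambda h) =
  block_form
    (fun z => 2^-1 * (refl phi1 z + refl phi2 z + refl phi3 z + refl phi4 z))
    (fun z => 2^-1 * ((refl phi1 z - refl phi3 z) + (refl phi2 z - refl phi4 z)))
    (fun z => 2^-1 * (refl phi1 z - refl phi2 z + refl phi3 z - refl phi4 z))
    (fun z => 2^-1 * ((refl phi1 z - refl phi3 z) - (refl phi2 z - refl phi4 z)))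
    h k.
Proof.
have r1L : refl phi1 \in Linfty R := Linfty_reflect lambda1 phi1L.
have r2L : refl phi2 \in Linfty R := Linfty_reflect lambda1 phi2L.
have r3L : refl phi3 \in Linfty R := Linfty_reflect lambda1 phi3L.
have r4L : refl phi4 \in Linfty R := Linfty_reflect lambda1 phi4L.
have DL (f g : R[i] -> R[i]^o) : f \in Linfty R -> g \in Linfty R ->
  (fun z => f z + g z) \in Linfty R by exact: circle_LfunD (leey _).
have BL (f g : R[i] -> R[i]^o) : f \in Linfty R -> g \in Linfty R ->
  (fun z => f z - g z) \in Linfty R by exact: circle_LfunB (leey _).
set r : R[i] := (sqrtC 2)^-1.
have rC : r^* = r by apply: CrealP; rewrite ger0_real// invr_ge0 sqrtC_ge0.
have rr : r * r = 2^-1 by rewrite -invfM -expr2 sqrtCK.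
have C1E (x : H2 R * H2 R) :
    H2val (C1_block lambda x).1 = r *: (conj_reflect lambda (H2val x.1) +
      conj_reflect lambda (H2val x.2)) /\
    H2val (C1_block lambda x).2 = r *: (conj_reflect lambda (H2val x.1) -
      conj_reflect lambda (H2val x.2)).
  by rewrite -!(H2val_C1 lambda1).
have [h1E h2E] := C1E h; have [k1E k2E] := C1E k.
move: (C1_block lambda h) h1E h2E => x x1 x2.
move: (C1_block lambda k) k1E k2E => y y1 y2.
rewrite /block_form {}x1 {}x2 {}y1 {}y2.
move: (H2val h.1) (H2val h.2) (H2val k.1) (H2val k.2) => h1 h2 k1 k2 {h k C1E}.
have pp phi : phi \in Linfty R -> forall u u' v v' : L2 R,
    mul_form phi (r *: (u + u')) (r *: (v + v')) = 2^-1 *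
    (mul_form phi u v + mul_form phi u v' + (mul_form phi u' v + mul_form phi u' v')).
  move=> pL u u' v v'; rewrite mul_formZl// mul_formDl// !mul_formZr//.
  by rewrite !mul_formDr// rC -mulrDr mulrA rr.
have pm phi : phi \in Linfty R -> forall u u' v v' : L2 R,
    mul_form phi (r *: (u + u')) (r *: (v - v')) = 2^-1 *
    (mul_form phi u v - mul_form phi u v' + (mul_form phi u' v - mul_form phi u' v')).
  by move=> pL u u' v v'; rewrite pp// !mul_formNr.
have mp phi : phi \in Linfty R -> forall u u' v v' : L2 R,
    mul_form phi (r *: (u - u')) (r *: (v + v')) = 2^-1 *
    (mul_form phi u v + mul_form phi u v' - (mul_form phi u' v + mul_form phi u' v')).
  by move=> pL u u' v v'; rewrite pp// !mul_formNl// opprD.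
have mm phi : phi \in Linfty R -> forall u u' v v' : L2 R,
    mul_form phi (r *: (u - u')) (r *: (v - v')) = 2^-1 *
    (mul_form phi u v - mul_form phi u v' - (mul_form phi u' v - mul_form phi u' v')).
  by move=> pL u u' v v'; rewrite mp// !mul_formNr.
rewrite pp// mp// pm// mm// !(mul_form_reflect lambda1)//.
have -> : forall u v, mul_form
    (fun z => 2^-1 * (refl phi1 z + refl phi2 z + refl phi3 z + refl phi4 z)) u v =
    2^-1 * (mul_form (refl phi1) u v + mul_form (refl phi2) u v +
            mul_form (refl phi3) u v + mul_form (refl phi4) u v).
  have L12 := DL _ _ r1L r2L; have L123 := DL _ _ L12 r3L.
  move=> u v; rewrite mul_formZ; last exact: (DL).
  by rewrite !mul_formD.
have -> : forall u v, mul_form (fun z => 2^-1 *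
      ((refl phi1 z - refl phi3 z) + (refl phi2 z - refl phi4 z))) u v =
    2^-1 * ((mul_form (refl phi1) u v - mul_form (refl phi3) u v) +
            (mul_form (refl phi2) u v - mul_form (refl phi4) u v)).
  have L13 := BL _ _ r1L r3L; have L24 := BL _ _ r2L r4L.
  move=> u v; rewrite mul_formZ; last exact: (DL).
  by rewrite mul_formD ?mul_formB.
have -> : forall u v, mul_form (fun z => 2^-1 *
      (refl phi1 z - refl phi2 z + refl phi3 z - refl phi4 z)) u v =
    2^-1 * (mul_form (refl phi1) u v - mul_form (refl phi2) u v +
            mul_form (refl phi3) u v - mul_form (refl phi4) u v).
  have L12 := BL _ _ r1L r2L; have L123 := DL _ _ L12 r3L.
  move=> u v; rewrite mul_formZ; last exact: (BL).
  by rewrite mul_formB// mul_formD// mul_formB.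
have -> : forall u v, mul_form (fun z => 2^-1 *
      ((refl phi1 z - refl phi3 z) - (refl phi2 z - refl phi4 z))) u v =
    2^-1 * ((mul_form (refl phi1) u v - mul_form (refl phi3) u v) -
            (mul_form (refl phi2) u v - mul_form (refl phi4) u v)).
  have L13 := BL _ _ r1L r3L; have L24 := BL _ _ r2L r4L.
  move=> u v; rewrite mul_formZ; last exact: (BL).
  by rewrite !mul_formB.
rewrite -/(refl phi1) -/(refl phi2) -/(refl phi3) -/(refl phi4).
set c : R[i] := 2^-1.
do 16!move: (mul_form _ _ _) => ?.
by ring.
Qed.

End ConjugatedForm.

Theorem theorem3p1 (R : realType) (lambda : R[i])
    (phi1 phi2 phi3 phi4 : R[i] -> R[i])
    (lambda1 : `|lambda| = 1)
    (phi1L : phi1 \in Linfty R) (phi2L : phi2 \in Linfty R)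
    (phi3L : phi3 \in Linfty R) (phi4L : phi4 \in Linfty R) :
  complex_symmetric (sum_dot H2dot)
    (block_toeplitz (mx2 phi1 phi2 phi3 phi4)) (C1_block lambda)
  <->
  [/\ ae_circle (fun z => phi1 z = 2^-1 *
         (phi1 (lambda * z^* ) + phi2 (lambda * z^* ) +
          phi3 (lambda * z^* ) + phi4 (lambda * z^* ))),
      ae_circle (fun z => phi2 z = 2^-1 *
         ((phi1 (lambda * z^* ) - phi3 (lambda * z^* )) +
          (phi2 (lambda * z^* ) - phi4 (lambda * z^* )))),
      ae_circle (fun z => phi3 z = 2^-1 *
         (phi1 (lambda * z^* ) - phi2 (lambda * z^* ) +
          phi3 (lambda * z^* ) - phi4 (lambda * z^* ))) &
      ae_circle (fun z => phi4 z = 2^-1 *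
         ((phi1 (lambda * z^* ) - phi3 (lambda * z^* )) -
          (phi2 (lambda * z^* ) - phi4 (lambda * z^* ))))].
Proof.
have Tb := block_toeplitz_bounded phi1L phi2L phi3L phi4L.
have Cc : conjugation (sum_dot H2dot) (C1_block lambda).
  by have := conjugation_block (inner_product_H2 R) (C1_conjugation lambda1).
have r1L := Linfty_reflect lambda1 phi1L; have r2L := Linfty_reflect lambda1 phi2L.
have r3L := Linfty_reflect lambda1 phi3L; have r4L := Linfty_reflect lambda1 phi4L.
have DL (f g : R[i] -> R[i]^o) : f \in Linfty R -> g \in Linfty R ->
  (fun z => f z + g z) \in Linfty R by exact: circle_LfunD (leey _).
have BL (f g : R[i] -> R[i]^o) : f \in Linfty R -> g \in Linfty R ->
  (fun z => f z - g z) \in Linfty R by exact: circle_LfunB (leey _).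
have ZL (f : R[i] -> R[i]^o) : f \in Linfty R -> (fun z => 2^-1 * f z) \in Linfty R.
  exact: circle_LfunZ (leey _).
have D12 := DL _ _ r1L r2L; have B12 := BL _ _ r1L r2L.
have B13 := BL _ _ r1L r3L; have B24 := BL _ _ r2L r4L.
have q1L := ZL _ (DL _ _ (DL _ _ D12 r3L) r4L).
have q2L := ZL _ (DL _ _ B13 B24).
have q3L := ZL _ (BL _ _ (DL _ _ B12 r3L) r4L).
have q4L := ZL _ (BL _ _ B13 B24).
apply: (iff_trans (complex_symmetric_form Tb Cc)).
apply: (iff_trans _ (block_form_eq phi1L phi2L phi3L phi4L q1L q2L q3L q4L)).
have form := block_toeplitz_form phi1L phi2L phi3L phi4L.
have form' := block_form_C1_block lambda1 phi1L phi2L phi3L phi4L.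
split=> sym h k; have hk := sym h k.
  exact: etrans (esym (form h k)) (etrans hk (etrans (form _ _) (form' h k))).
exact: etrans (form h k) (etrans hk (esym (etrans (form _ _) (form' h k)))).
Qed.
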